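(* Let $\rho>0$, $\beta\in(0,1)$, and let $\mathbf{X}\in\mathbb{R}^{d\times n}$ have all columns in $\mathcal{B}_d$. Run $\mathrm{SeparateCov}$ on $\mathbf{X}$ with parameter $\rho$. Then with probability at least $1-\beta$ the output satisfies $$\|\widetilde{\mathbf{\Sigma}}_{\mathrm{Sep}}-\mathbf{\Sigma}\|_F\le \frac{2^{1.25}\sqrt{\mathrm{tr}}}{\rho^{1/4}\sqrt n}\sqrt{\upsilon(d,\beta/2)}+\frac{\sqrt2}{\sqrt\rho\, n}\,\eta(d,\beta/2),$$ in particular $\|\widetilde{\mathbf{\Sigma}}_{\mathrm{Sep}}-\mathbf{\Sigma}\|_F=\tilde O\big(d^{1/4}\sqrt{\mathrm{tr}}/\sqrt n+\sqrt d/n\big)$, where $\tilde O$ hides dependence on $\rho,\beta$ and polylogarithmic factors.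
   Context: $\mathcal{B}_d$ is the closed unit $\ell_2$-ball in $\mathbb{R}^d$. $\mathbf{\Sigma}=\frac1n\mathbf{X}\mathbf{X}^T$ with eigendecomposition $\mathbf{\Sigma}=\mathbf{P}\mathbf{\Lambda}\mathbf{P}^T$, $\mathbf{\Lambda}=\mathrm{diag}(\lambda_1,\dots,\lambda_d)$, $\lambda_1\ge\dots\ge\lambda_d$, and $\mathrm{tr}=\sum_k\lambda_k=\frac1n\sum_i\|X_i\|_2^2$. For a symmetric matrix $\mathbf{A}$, $\mathbf{P}[\mathbf{A}]$ denotes an orthogonal matrix whose $j$-th column is a unit eigenvector for the $j$-th largest eigenvalue of $\mathbf{A}$. $\mathrm{SGW}(d)$ is the law of a symmetric $d\times d$ random matrix $\mathbf{W}$ with $w_{j,k}\sim\mathcal{N}(0,1)$ i.i.d. for $j\le k$ and $w_{k,j}=w_{j,k}$. $\mathrm{GaussCov}(\mathbf{X},\rho')$ outputs $\mathbf{\Sigma}+\frac{1}{\sqrt{\rho'}n}\mathbf{W}$ with $\mathbf{W}\sim\mathrm{SGW}(d)$. $\mathrm{SeparateCov}(\mathbf{X},\rho)$: (1) set $\widetilde{\mathbf{\Lambda}}_{\mathrm{Sep}}=\mathbf{\Lambda}+\frac{\sqrt2}{\sqrt\rho n}\mathrm{diag}(Y)$ with $Y\sim\mathcal{N}(0,\mathbf{I}_d)$; (2) set $\widetilde{\mathbf{\Sigma}}_{\mathrm{Gau}}=\mathrm{GaussCov}(\mathbf{X},\rho/2)$ (independent noise); (3) $\widetilde{\mathbf{P}}_{\mathrm{Sep}}=\mathbf{P}[\widetilde{\mathbf{\Sigma}}_{\mathrm{Gau}}]$;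 (4) output $\widetilde{\mathbf{\Sigma}}_{\mathrm{Sep}}=\widetilde{\mathbf{P}}_{\mathrm{Sep}}\widetilde{\mathbf{\Lambda}}_{\mathrm{Sep}}\widetilde{\mathbf{P}}_{\mathrm{Sep}}^T$. The functions are $\eta(d,\beta)=\sqrt{d+2\sqrt{d\log(1/\beta)}+2\log(1/\beta)}$ and $$\upsilon(d,\beta)=2\sqrt d+2d^{1/6}\log^{1/3}d+\frac{6(1+(\log d/d)^{1/3})\sqrt{\log d}}{\sqrt{\log(1+(\log d/d)^{1/3})}}+2\sqrt{2\log(1/\beta)}.$$ Logarithms are natural, with the convention $\log(x)=1$ for $x\le e$. *)

(* Defs.v *)
From HB Require Import structures.
From mathcomp Require Import all_boot all_order all_algebra.
From mathcomp Require Import all_classical all_reals all_analysis.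
Set Implicit Arguments. Unset Strict Implicit. Unset Printing Implicit Defensive.
Import Order.TTheory GRing.Theory Num.Theory.
Local Open Scope classical_set_scope.
Local Open Scope ring_scope.

Section defs.
Context {R : realType}.

(* natural logarithm with the paper's convention log x = 1 for x <= e *)
Definition logc (x : R) : R := if x <= expR 1 then 1 else ln x.

Definition eta_fn (d : nat) (beta : R) : R :=
  Num.sqrt (d%:R + 2 * Num.sqrt (d%:R * logc beta^-1) + 2 * logc beta^-1).

Definition upsilon_fn (d : nat) (beta : R) : R :=
  let eps := (logc d%:R / d%:R) `^ (3%:R^-1) in
  2 * Num.sqrt d%:R + 2 * (d%:R `^ (6%:R^-1)) * (logc d%:R `^ (3%:R^-1))
  + 6 * (1 + eps) * Num.sqrt (logc d%:R) / Num.sqrt (ln (1 + eps))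
  + 2 * Num.sqrt (2 * logc beta^-1).

Definition frob {m n : nat} (M : 'M[R]_(m, n)) : R :=
  Num.sqrt (\sum_(i < m) \sum_(j < n) M i j ^+ 2).

Definition empCov {d n : nat} (X : 'M[R]_(d, n)) : 'M[R]_d :=
  (n%:R)^-1 *: (X *m X^T).

Definition sorted_eigdecomp {d : nat} (A Q : 'M[R]_d) (lam : 'rV[R]_d) : Prop :=
  Q *m Q^T = 1%:M /\ A = Q *m diag_mx lam *m Q^T /\
  (forall i j : 'I_d, (i <= j)%N -> lam 0 j <= lam 0 i).

Definition eigvec_selector {d : nat} (Psel : 'M[R]_d -> 'M[R]_d) : Prop :=
  forall A : 'M[R]_d, A^T = A -> exists mu : 'rV[R]_d, sorted_eigdecomp A (Psel A) mu.

Definition sym_from {d : nat} (w : 'I_d * 'I_d -> R) : 'M[R]_d :=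
  \matrix_(j, k) (if (j <= k)%N then w (j, k) else w (k, j)).

(* output of SeparateCov given the noise realisations y (for Y ~ N(0, I_d))
   and w (upper-triangular entries of W ~ SGW(d)) *)
Definition separateCov {d n : nat} (X : 'M[R]_(d, n)) (lam : 'rV[R]_d)
    (Psel : 'M[R]_d -> 'M[R]_d) (rho : R) (y : 'I_d -> R)
    (w : 'I_d * 'I_d -> R) : 'M[R]_d :=
  let LamSep := diag_mx (lam + (Num.sqrt 2 / (Num.sqrt rho * n%:R)) *: \row_i y i) in
  let SigGau := empCov X + (Num.sqrt (rho / 2) * n%:R)^-1 *: sym_from w in
  let PSep := Psel SigGau in
  PSep *m LamSep *m PSep^T.

Definition mutually_independent {dT : measure_display} {T : measurableType dT}
    (P : probability T R) {I : finType} (g : I -> T -> R) : Prop :=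
  forall (J : {set I}) (B : I -> set R), (forall i, measurable (B i)) ->
    P (\bigcap_(i in [set` J]) (g i @^-1` B i)) =
    (\prod_(i in J) P (g i @^-1` B i))%E.

End defs.

(* Main.v *)
Require Import Defs.
From HB Require Import structures.
From mathcomp Require Import all_boot all_order all_algebra.
From mathcomp Require Import all_classical all_reals all_analysis.
From mathcomp Require Import measurable_realfun ring lra.
Set Implicit Arguments. Unset Strict Implicit. Unset Printing Implicit Defensive.
Import Order.TTheory GRing.Theory Num.Theory.
Local Open Scope classical_set_scope.
Local Open Scope ring_scope.

(** Write [S] for the empirical covariance, [c = sqrt 2 / (sqrt rho n)],
[B = S + c W = P M P^T].  The trace inequality [<S, B> <= sum lam_i mu_i] gives
[|P Lam P^T - S|_F^2 <= 2 c <P Lam P^T - S, W> <= 4 c tr |W|_op], while the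
eigenvalue noise contributes [c |Y|_2].  It remains to bound two tails.

[|Y|_2^2] is controlled by the Laurent-Massart bound, i.e. Chernoff with
[E exp (a y^2) = (1 - 2 a)^(-1/2)].

For [|W|_op], averaging over extra independent diagonal noise reduces [W] to the
Gaussian orthogonal ensemble [G], which is invariant under conjugation by
rotations.  Let [a] be the last diagonal entry of [G], [x] the rest of its last
column and [G'] the complementary block.  By AM-GM,
[|v^T G v| + c s^2 <= (|a| + |x| + c) s^2 + |v'^T G' v'| + <x, v'>^2 / |x|] for
[v = (v', s)], and by invariance [x] may be rotated to a multiple of the last basis
vector of [G'].  Iterating (this is Householder tridiagonalization), [|G|_op > t]
forces [|a_k| + chi_k + chi_(k-1) > t] for some [k], where [a_k ~ N(0, 2)]
and the chi variables are independent; since [E exp (th chi_k) <=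
exp (th sqrt k + th^2 / 2)], the union bound yields
[P(|W|_op > 2 sqrt d + s) <= 4 (d + 1) exp (- s^2 / 8)].

Expectations over independent Gaussians are iterated one-dimensional integrals;
their rotation invariance comes from writing a plane rotation as three shears. *)

(** The leading term [2 sqrt d] of [upsilon_fn] is sharp for a Wigner matrix, so an epsilon-net
    argument, which loses a constant factor, is ruled out. Tridiagonalization keeps the constant,
    since each row of the tridiagonal matrix contributes two chi variables of size about [sqrt d] at
    most. The room for the union bound over the rows comes from the term in [sqrt (log d)]. The
    rotation that straightens [x] is random, but it depends only on the border, which is independent
    of the remaining block; integrating the block innermost makes it a fixed rotation. The ensemble
    is represented by a nonsymmetric matrix [M] with independent entries: multiplying [M] on either
    side by a plane rotation rotates disjoint pairs of entries, so invariance in two dimensions is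
    enough. On the upper triangle of a symmetric matrix, conjugation mixes three entries of unequal
    variances. The extra diagonal noise needs no new variables: the event about [W] does not involve
    [Y], so [Y] itself serves as that noise. *)

(** * Lebesgue measure in the plane: translations, shears, rotations *)

Section lebesgue_shear.
Context {R : realType}.
Local Notation mR := (measurableTypeR R).
Local Notation mu := (@lebesgue_measure R).
Local Open Scope ereal_scope.

(** The two target types are convertible; the lemma switches between them so that measurability
    lemmas for [R]-valued functions apply. *)
Lemma measurable_fun_mR d (T : measurableType d) (f : T -> R) :
  measurable_fun setT f -> measurable_fun setT (f : T -> mR).
Proof. by []. Qed.

(** Lebesgue measure is determined by the lengths of half-open intervals, and its image under a
    translation gives them the same lengths. *)
Lemma integral_translate (a : R) (f : mR -> \bar R) :
  measurable_fun setT f -> (forall x, 0 <= f x) ->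
  \int[mu]_x f (x + a)%R = \int[mu]_x f x.
Proof.
move=> mf f0.
pose T (x : mR) : mR := (x + a)%R.
have mT : measurable_fun setT T.
  by apply: measurable_fun_mR; apply: measurable_funD.
rewrite (_ : \int[mu]_x f (x + a)%R = \int[mu]_(x in T @^-1` setT) (f \o T) x)//.
rewrite -(ge0_integral_pushforward mT)//.
apply: eq_measure_integral => A mA _; apply/esym.
apply: lebesgue_measure_unique => // X [[b c] _ <-] /=.
rewrite /pushforward.
have -> : T @^-1` `]b, c]%classic = `](b - a)%R, (c - a)%R]%classic.
  by apply/seteqP; split => x /=; rewrite !in_itv/= ltrBlDr lerBrDr.
rewrite !lebesgue_measure_itv/= !lte_fin ltrD2r.
by case: ifP => // _; rewrite -!EFinB; congr EFin; ring.
Qed.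

Lemma measurable_lin2 (b b' : R) :
  measurable_fun setT (fun z : mR * mR => (b * z.1 + b' * z.2)%R : mR).
Proof.
apply: measurable_fun_mR; apply: measurable_funD.
  by apply: measurable_funM => //; exact: measurable_fst.
by apply: measurable_funM => //; exact: measurable_snd.
Qed.

Lemma lebesgue2_shear2 (a : R) (f : mR * mR -> \bar R) :
  measurable_fun setT f -> (forall x, 0 <= f x) ->
  \int[mu]_x \int[mu]_y f (x, (y + a * x)%R) = \int[mu]_x \int[mu]_y f (x, y).
Proof.
move=> mf f0; apply: eq_integral => x _.
apply: (@integral_translate _ (fun y => f (x, y))) => //.
by apply: measurableT_comp.
Qed.

Lemma lebesgue2_shear1 (a : R) (f : mR * mR -> \bar R) :
  measurable_fun setT f -> (forall x, 0 <= f x) ->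
  \int[mu]_x \int[mu]_y f ((x + a * y)%R, y) = \int[mu]_x \int[mu]_y f (x, y).
Proof.
(* Tonelli on both sides moves the sheared variable into the inner integral, where the shear is a
   translation. *)
move=> mf f0; rewrite (fubini_tonelli _ mf)//.
rewrite (fubini_tonelli (fun z : mR * mR => f ((z.1 + a * z.2)%R : mR, z.2)))//=; last first.
  apply: measurableT_comp => //; apply: measurable_fun_pair => //.
  by under eq_fun do rewrite -[_.1]mul1r; exact: measurable_lin2.
apply: eq_integral => y _.
apply: (@integral_translate _ (fun x => f (x, y))) => //.
by apply: measurableT_comp.
Qed.

(* A plane rotation is a product of three shears. *)
Lemma lebesgue2_rot (c s : R) (f : mR * mR -> \bar R) :
  (c ^+ 2 + s ^+ 2 = 1)%R -> s != 0%R ->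
  measurable_fun setT f -> (forall x, 0 <= f x) ->
  \int[mu]_x \int[mu]_y f ((c * x - s * y)%R, (s * x + c * y)%R) =
  \int[mu]_x \int[mu]_y f (x, y).
Proof.
(* For a rotation by the angle [theta], this is [- tan (theta / 2)]: the outer two shears have
   parameter [a], the middle one [s]. *)
move=> cs s0 mf f0; pose a := ((c - 1) / s)%R.
pose f1 (z : mR * mR) := f ((z.1 + a * z.2)%R : mR, z.2).
have mf1 : measurable_fun setT f1.
  apply: measurableT_comp => //; apply: measurable_fun_pair => //.
  by under eq_fun do rewrite -[_.1]mul1r; exact: measurable_lin2.
pose f2 (z : mR * mR) := f1 (z.1, (z.2 + s * z.1)%R : mR).
have mf2 : measurable_fun setT f2.
  apply: measurableT_comp => //; apply: measurable_fun_pair => //.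
  by under eq_fun do rewrite addrC -[_.2]mul1r; exact: measurable_lin2.
transitivity (\int[mu]_x \int[mu]_y f2 ((x + a * y)%R, y)); last first.
  have H2 : \int[mu]_x \int[mu]_y f2 (x, y) = \int[mu]_x \int[mu]_y f1 (x, y).
    exact: (lebesgue2_shear2 s mf1 (fun=> f0 _)).
  have H1 : \int[mu]_x \int[mu]_y f1 (x, y) = \int[mu]_x \int[mu]_y f (x, y).
    exact: (lebesgue2_shear1 a mf f0).
  by rewrite -H1 -H2; exact: (lebesgue2_shear1 a mf2 (fun=> f0 _)).
apply: eq_integral => x _; apply: eq_integral => y _; rewrite /f2 /f1 /=.
have sa : (s * a = c - 1)%R by rewrite /a mulrC divfK.
have E2 : (s * x + c * y = y + s * (x + a * y))%R.
  by rewrite mulrDr mulrA sa; ring.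
have E1 : (c * x - s * y = x + a * y + a * (y + s * (x + a * y)))%R.
  (* Multiplying by [s] clears the denominator of [a]; the difference is then a multiple of
     [c ^+ 2 + s ^+ 2 - 1]. *)
  apply: (mulfI s0); apply/eqP; rewrite -subr_eq0; apply/eqP.
  transitivity (((c ^+ 2 + s ^+ 2) - 1) * - y)%R; last by rewrite cs; ring.
  rewrite (_ : _ - _ = s * (c * x - s * y) - (s * x + (s * a) * y +
     (s * a) * y + (s * a) * (s * x + (s * a) * y)))%R; last by ring.
  by rewrite sa; ring.
by rewrite E1 E2.
Qed.

End lebesgue_shear.

(** * Integration against the standard Gaussian density *)

Section gauss_integral.
Context {R : realType}.
Local Notation mR := (measurableTypeR R).
Local Notation mu := (@lebesgue_measure R).
Local Notation phi := (@normal_pdf R 0 1).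
Local Open Scope ereal_scope.

(** Applied to nonnegative functions with extended values, so that linearity and Tonelli require
    measurability but no integrability. *)
Definition gauss_int (f : mR -> \bar R) : \bar R := \int[mu]_x (f x * (phi x)%:E).

Lemma phi_ge0 (x : R) : 0 <= (phi x)%:E.
Proof. by rewrite lee_fin normal_pdf_ge0. Qed.

Lemma measurable_phi : measurable_fun setT (fun x : mR => (phi x)%:E).
Proof. by apply/measurable_EFinP; exact: measurable_normal_pdf. Qed.

Lemma gauss_int_ge0 f : (forall x, 0 <= f x) -> 0 <= gauss_int f.
Proof. by move=> f0; apply: integral_ge0 => x _; rewrite mule_ge0// phi_ge0. Qed.

Lemma measurable_gauss_int_integrand (f : mR -> \bar R) : measurable_fun setT f ->
  measurable_fun setT (fun x : mR => f x * (phi x)%:E).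
Proof. by move=> mf; apply: emeasurable_funM => //; exact: measurable_phi. Qed.

Lemma gauss_int_le f g : measurable_fun setT f -> measurable_fun setT g ->
  (forall x, 0 <= f x) -> (forall x, f x <= g x) -> gauss_int f <= gauss_int g.
Proof.
move=> mf mg f0 fg; have g0 x : 0 <= g x := le_trans (f0 x) (fg x).
apply: ge0_le_integral => //.
- by move=> x _; rewrite mule_ge0// phi_ge0.
- exact: measurable_gauss_int_integrand.
- exact: measurable_gauss_int_integrand.
- by move=> x _; rewrite lee_wpmul2r// phi_ge0.
Qed.

Lemma gauss_int_cst k : 0 <= k -> gauss_int (fun=> k) = k.
Proof.
move=> k0; rewrite /gauss_int ge0_integralZl//; last by move=> x _; exact: phi_ge0.
  by rewrite integral_normal_pdf mule1.
exact: measurable_phi.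
Qed.

Lemma gauss_intZl k f : 0 <= k -> measurable_fun setT f -> (forall x, 0 <= f x) ->
  gauss_int (fun x => k * f x) = k * gauss_int f.
Proof.
move=> k0 mf f0; rewrite /gauss_int -ge0_integralZl//.
- by apply: eq_integral => x _; rewrite muleA.
- exact: measurable_gauss_int_integrand.
- by move=> x _; rewrite mule_ge0// phi_ge0.
Qed.

Lemma gauss_intD f g : measurable_fun setT f -> measurable_fun setT g ->
  (forall x, 0 <= f x) -> (forall x, 0 <= g x) ->
  gauss_int (fun x => f x + g x) = gauss_int f + gauss_int g.
Proof.
move=> mf mg f0 g0; rewrite /gauss_int -ge0_integralD//.
- by apply: eq_integral => x _; rewrite ge0_muleDl.
- by move=> x _; rewrite mule_ge0// phi_ge0.
- exact: measurable_gauss_int_integrand.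
- by move=> x _; rewrite mule_ge0// phi_ge0.
- exact: measurable_gauss_int_integrand.
Qed.

Lemma gauss_int_nneseries (f : nat -> mR -> \bar R) :
  (forall n, measurable_fun setT (f n)) -> (forall n x, 0 <= f n x) ->
  gauss_int (fun x => \sum_(n <oo) f n x) = \sum_(n <oo) gauss_int (f n).
Proof.
move=> mf f0; rewrite /gauss_int.
under eq_integral => x _.
  rewrite muleC -nneseriesZl//.
  under eq_eseriesr do rewrite muleC.
  over.
rewrite integral_nneseries//.
- by move=> n; exact: measurable_gauss_int_integrand.
- by move=> n x _; rewrite mule_ge0// phi_ge0.
Qed.

Lemma measurable_gauss_int2 d (S : measurableType d) (f : S * mR -> \bar R) :
  measurable_fun setT f -> (forall z, 0 <= f z) ->
  measurable_fun setT (fun s => gauss_int (fun x => f (s, x))).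
Proof.
move=> mf f0.
apply: (measurable_fun_fubini_tonelli_F (fun z : S * mR => f z * (phi z.2)%:E)).
  apply: emeasurable_funM => //.
  by apply: (measurableT_comp measurable_phi); exact: measurable_snd.
by move=> x; rewrite mule_ge0// phi_ge0.
Qed.

(** The joint density depends on [x ^+ 2 + y ^+ 2] alone, which is what makes it invariant under
    rotations. *)
Lemma phi2E (x y : R) :
  (phi x)%:E * (phi y)%:E = ((normal_peak 1 ^+ 2) * expR (- (x ^+ 2 + y ^+ 2) / 2))%:E.
Proof.
rewrite -EFinM !normal_pdfE ?oner_neq0//; congr EFin.
rewrite mulrACA -expr2 /normal_fun -expRD !subr0 expr1n; congr (_ * expR _)%R.
by field.
Qed.

Lemma gauss_int2E (f : mR * mR -> \bar R) :
  measurable_fun setT f -> (forall z, 0 <= f z) ->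
  gauss_int (fun x => gauss_int (fun y => f (x, y))) =
  \int[mu]_x \int[mu]_y
    (f (x, y) * ((normal_peak 1 ^+ 2) * expR (- (x ^+ 2 + y ^+ 2) / 2))%:E).
Proof.
move=> mf f0; rewrite /gauss_int; apply: eq_integral => x _.
rewrite muleC -ge0_integralZl ?phi_ge0//.
- by apply: eq_integral => y _; rewrite -phi2E muleC -muleA [X in _ * X]muleC.
- apply: measurable_gauss_int_integrand; exact: measurableT_comp.
- by move=> y _; rewrite mule_ge0// phi_ge0.
Qed.

Lemma measurable_phi2 : measurable_fun setT (fun z : mR * mR =>
  ((normal_peak 1 ^+ 2) * expR (- (z.1 ^+ 2 + z.2 ^+ 2) / 2) : R)%:E).
Proof.
apply/measurable_EFinP; apply: measurable_funM => //.
apply: measurableT_comp => //; apply: measurable_funM => //.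
apply: measurableT_comp => //; apply: measurable_funD.
  by apply: measurable_funX; exact: measurable_fst.
by apply: measurable_funX; exact: measurable_snd.
Qed.

Lemma gauss_int_swap (f : mR * mR -> \bar R) :
  measurable_fun setT f -> (forall z, 0 <= f z) ->
  gauss_int (fun x => gauss_int (fun y => f (x, y))) = gauss_int (fun y => gauss_int (fun x => f (x, y))).
Proof.
move=> mf f0; rewrite gauss_int2E//.
have mg : measurable_fun setT (fun z : mR * mR => f (z.2, z.1)).
  apply: measurableT_comp => //; exact: measurable_swap.
rewrite (gauss_int2E mg)//=.
apply: (etrans (fubini_tonelli (fun z : mR * mR => f z *
  ((normal_peak 1 ^+ 2) * expR (- (z.1 ^+ 2 + z.2 ^+ 2) / 2))%:E) _ _)) => /=.
- by apply: emeasurable_funM => //; exact: measurable_phi2.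
- by move=> z; rewrite mule_ge0// lee_fin mulr_ge0// ?sqr_ge0 ?expR_ge0.
- by apply: eq_integral => x _; apply: eq_integral => y _; rewrite [(y ^+ 2 + _)%R]addrC.
Qed.

Lemma gauss_int_rot (c s : R) (f : mR * mR -> \bar R) :
  (c ^+ 2 + s ^+ 2 = 1)%R -> s != 0%R ->
  measurable_fun setT f -> (forall z, 0 <= f z) ->
  gauss_int (fun x => gauss_int (fun y => f ((c * x - s * y)%R, (s * x + c * y)%R))) =
  gauss_int (fun x => gauss_int (fun y => f (x, y))).
Proof.
move=> cs s0 mf f0.
have mg : measurable_fun setT (fun z : mR * mR =>
    f ((c * z.1 - s * z.2)%R : mR, (s * z.1 + c * z.2)%R : mR)).
  apply: measurableT_comp => //; apply: measurable_fun_pair; last exact: measurable_lin2.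
  by under eq_fun do rewrite -mulNr; exact: measurable_lin2.
rewrite (gauss_int2E mg)//= gauss_int2E//.
rewrite -(lebesgue2_rot (f := fun z : mR * mR => f z *
  ((normal_peak 1 ^+ 2) * expR (- (z.1 ^+ 2 + z.2 ^+ 2) / 2))%:E) cs s0)/=.
- apply: eq_integral => x _; apply: eq_integral => y _; congr (_ * (_ * expR (- _ / 2))%:E)%E.
  transitivity ((c ^+ 2 + s ^+ 2) * (x ^+ 2 + y ^+ 2))%R; first by rewrite cs mul1r.
  by ring.
- by apply: emeasurable_funM => //; exact: measurable_phi2.
- by move=> z; rewrite mule_ge0// lee_fin mulr_ge0// ?sqr_ge0 ?expR_ge0.
Qed.

(** Completing the square leaves the density of the normal law with mean [t], of total mass 1. *)
Lemma gauss_int_expR (t : R) : gauss_int (fun x => (expR (t * x))%:E) = (expR (t ^+ 2 / 2))%:E.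
Proof.
rewrite /gauss_int.
under eq_integral => x _.
  rewrite -EFinM normal_pdfE ?oner_neq0// mulrCA /normal_fun -expRD.
  rewrite (_ : t * x + _ = t ^+ 2 / 2 + - (x - t) ^+ 2 / (1 ^+ 2 *+ 2))%R; last first.
    by rewrite expr1n; field.
  rewrite expRD mulrCA EFinM -/(normal_fun t 1 x).
  over.
rewrite ge0_integralZl//; last first.
- by move=> x _; rewrite lee_fin mulr_ge0 ?normal_peak_ge0 ?expR_ge0.
- apply/measurable_EFinP; apply: measurable_funM => //; exact: measurable_normal_fun.
have := integral_normal_pdf t 1; rewrite normal_pdfE ?oner_neq0// => ->.
by rewrite mule1.
Qed.

(** The integrand is [s] times the centered normal density of standard deviation
    [s = (1 - 2 a)^(-1/2)]. *)
Lemma gauss_int_expR_sqr (a : R) : (a < 1 / 2)%R ->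
  gauss_int (fun x => (expR (a * x ^+ 2))%:E) = ((Num.sqrt (1 - 2 * a))^-1)%:E.
Proof.
move=> a12; have b0 : (0 < 1 - 2 * a)%R by lra.
set s := ((Num.sqrt (1 - 2 * a))^-1)%R.
have s0 : (0 < s)%R by rewrite invr_gt0 sqrtr_gt0.
have s2 : (s ^+ 2 = (1 - 2 * a)^-1)%R by rewrite /s exprVn sqr_sqrtr// ltW.
have pk : (normal_peak 1 = s * normal_peak s)%R.
  rewrite /normal_peak expr1n mul1r -mulrnAr sqrtrM ?sqr_ge0// sqrtr_sqr gtr0_norm//.
  by rewrite invfM mulrA divff ?mul1r// gt_eqF.
rewrite /gauss_int.
under eq_integral => x _.
  rewrite -EFinM normal_pdfE ?oner_neq0// mulrCA /normal_fun -expRD.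
  rewrite (_ : a * x ^+ 2 + _ = - (x - 0) ^+ 2 / (s ^+ 2 *+ 2))%R; last first.
    rewrite s2 subr0 expr1n; field.
    by rewrite gt_eqF.
  rewrite pk -mulrA EFinM -/(normal_fun 0 s x).
  over.
rewrite ge0_integralZl//; last first.
- by rewrite lee_fin ltW.
- by move=> x _; rewrite lee_fin mulr_ge0 ?normal_peak_ge0 ?expR_ge0.
- apply/measurable_EFinP; apply: measurable_funM => //; exact: measurable_normal_fun.
have := integral_normal_pdf 0 s; rewrite normal_pdfE ?gt_eqF// => ->.
by rewrite mule1.
Qed.

End gauss_integral.

(** * Iterated Gaussian integrals over families of coordinates *)

Section gauss_iterated.
Context {R : realType} {I : eqType}.
Local Notation mR := (measurableTypeR R).
Implicit Types (w : I -> R) (F G : (I -> R) -> \bar R).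

Definition upd w (i : I) (x : R) : I -> R := fun j => if j == i then x else w j.

(* Measurability of a function of the coordinate family [w : I -> R], tested on
   all measurably parametrized families; this needs no sigma-algebra on [I -> R]. *)
Definition mvar dU (U : sigmaRingType dU) (F : (I -> R) -> U) : Prop :=
  forall d (S : measurableType d) (h : I -> S -> R),
    (forall i, measurable_fun setT (h i)) ->
    measurable_fun setT (fun s => F (fun i => h i s)).

(** The result is again a function of the whole family, constant in coordinate [i]; partial
    integrals can thus be iterated and reordered, and read as conditional expectations. *)
Definition gauss_coord (i : I) F : (I -> R) -> \bar R := fun w => gauss_int (fun x => F (upd w i x)).

Definition gauss_coords (s : seq I) F : (I -> R) -> \bar R := foldr gauss_coord F s.

Lemma updC w i j x y : i != j -> upd (upd w i x) j y = upd (upd w j y) i x.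
Proof.
move=> ij; apply/funext => k; rewrite /upd.
by case: eqVneq => // ->; rewrite eq_sym (negPf ij).
Qed.

Lemma mvar_upd dU (U : sigmaRingType dU) (F : (I -> R) -> U) w i :
  mvar F -> measurable_fun setT (fun x : mR => F (upd w i x)).
Proof.
move=> mF; apply: (mF _ mR (fun j x => upd w i x j)) => j.
by rewrite /upd; case: eqP.
Qed.

Lemma mvar_upd2 F w i j : mvar F ->
  measurable_fun setT (fun z : mR * mR => F (upd (upd w i z.1) j z.2)).
Proof.
move=> mF; apply: (mF _ (mR * mR)%type (fun k z => upd (upd w i z.1) j z.2 k)) => k.
rewrite /upd; case: eqP => _; first exact: measurable_snd.
by case: eqP => _; [exact: measurable_fst|exact: measurable_cst].
Qed.

Lemma mvar_comp dU (U : sigmaRingType dU) (F : (I -> R) -> U) (T : (I -> R) -> I -> R) :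
  (forall i, mvar (fun w => T w i)) -> mvar F -> mvar (fun w => F (T w)).
Proof.
move=> mT mF d S h mh; apply: (mF _ S (fun i s => T (fun j => h j s) i)) => i.
exact: mT.
Qed.

Lemma mvar_proj i : mvar (fun w => w i). Proof. by move=> d S h; apply. Qed.

Local Open Scope ereal_scope.

Lemma gauss_coord_ge0 i F : (forall w, 0 <= F w) -> forall w, 0 <= gauss_coord i F w.
Proof. by move=> F0 w; apply: gauss_int_ge0. Qed.

Lemma gauss_coords_ge0 s F : (forall w, 0 <= F w) -> forall w, 0 <= gauss_coords s F w.
Proof. by move=> F0; elim: s => //= i s IH w; exact: gauss_coord_ge0. Qed.

Lemma mvar_gauss_coord i F : mvar F -> (forall w, 0 <= F w) -> mvar (gauss_coord i F).
Proof.
move=> mF F0 d S h mh; rewrite /gauss_coord.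
apply: (measurable_gauss_int2 (f := fun z : S * mR => F (upd (fun j => h j z.1) i z.2))) => //.
apply: (mF _ _ (fun k (z : S * mR) => upd (fun j => h j z.1) i z.2 k)) => k.
rewrite /upd; case: eqP => _; first exact: measurable_snd.
by apply: measurableT_comp => //; exact: measurable_fst.
Qed.

Lemma mvar_gauss_coords s F : mvar F -> (forall w, 0 <= F w) -> mvar (gauss_coords s F).
Proof. by move=> mF F0; elim: s => //= i s IH; apply: mvar_gauss_coord => //; exact: gauss_coords_ge0. Qed.

Lemma gauss_coord_le i F G : mvar F -> mvar G -> (forall w, 0 <= F w) ->
  (forall w, F w <= G w) -> forall w, gauss_coord i F w <= gauss_coord i G w.
Proof. by move=> mF mG F0 FG w; apply: gauss_int_le => //; exact: mvar_upd. Qed.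

Lemma gauss_coords_le s F G : mvar F -> mvar G -> (forall w, 0 <= F w) ->
  (forall w, F w <= G w) -> forall w, gauss_coords s F w <= gauss_coords s G w.
Proof.
move=> mF mG F0 FG; have G0 w : 0 <= G w := le_trans (F0 w) (FG w).
elim: s => //= i s IH w.
by apply: gauss_coord_le => //; [exact: mvar_gauss_coords|exact: mvar_gauss_coords|exact: gauss_coords_ge0].
Qed.

Lemma gauss_coordD i F G : mvar F -> mvar G -> (forall w, 0 <= F w) -> (forall w, 0 <= G w) ->
  gauss_coord i (fun w => F w + G w) = fun w => gauss_coord i F w + gauss_coord i G w.
Proof. by move=> mF mG F0 G0; apply/funext => w; rewrite /gauss_coord gauss_intD//; exact: mvar_upd. Qed.

Lemma gauss_coordsD s F G : mvar F -> mvar G -> (forall w, 0 <= F w) -> (forall w, 0 <= G w) ->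
  gauss_coords s (fun w => F w + G w) = fun w => gauss_coords s F w + gauss_coords s G w.
Proof.
move=> mF mG F0 G0; elim: s => //= i s ->.
by rewrite gauss_coordD//; [exact: mvar_gauss_coords|exact: mvar_gauss_coords|exact: gauss_coords_ge0|exact: gauss_coords_ge0].
Qed.

Lemma gauss_coordZl i (K : (I -> R) -> \bar R) F : mvar F -> (forall w, 0 <= F w) ->
  (forall w, 0 <= K w) -> (forall w x, K (upd w i x) = K w) ->
  gauss_coord i (fun w => K w * F w) = fun w => K w * gauss_coord i F w.
Proof.
move=> mF F0 K0 Ki; apply/funext => w; rewrite /gauss_coord.
under [X in gauss_int X]eq_fun do rewrite Ki.
by rewrite gauss_intZl//; exact: mvar_upd.
Qed.

Lemma gauss_coordsZl s (K : (I -> R) -> \bar R) F : mvar F -> (forall w, 0 <= F w) ->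
  (forall w, 0 <= K w) -> (forall i w x, i \in s -> K (upd w i x) = K w) ->
  gauss_coords s (fun w => K w * F w) = fun w => K w * gauss_coords s F w.
Proof.
move=> mF F0 K0; elim: s => //= i s IH Ki.
rewrite IH; last by move=> j w x js; rewrite Ki// in_cons js orbT.
rewrite gauss_coordZl//; [exact: mvar_gauss_coords|exact: gauss_coords_ge0|].
by move=> w x; rewrite Ki// mem_head.
Qed.

Lemma gauss_coord_id i F : (forall w, 0 <= F w) -> (forall w x, F (upd w i x) = F w) ->
  gauss_coord i F = F.
Proof.
by move=> F0 Fi; apply/funext => w; rewrite /gauss_coord; under eq_fun do rewrite Fi; rewrite gauss_int_cst.
Qed.

Lemma gauss_coords_id s F : (forall w, 0 <= F w) -> (forall i w x, i \in s -> F (upd w i x) = F w) ->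
  gauss_coords s F = F.
Proof.
move=> F0; elim: s => //= i s IH Fi; rewrite IH ?gauss_coord_id//.
  by move=> w x; rewrite Fi// mem_head.
by move=> j w x js; rewrite Fi// in_cons js orbT.
Qed.

Lemma gauss_coords_cat s1 s2 F : gauss_coords (s1 ++ s2) F = gauss_coords s1 (gauss_coords s2 F).
Proof. by rewrite /gauss_coords foldr_cat. Qed.

Lemma gauss_coordC i j F : mvar F -> (forall w, 0 <= F w) -> gauss_coord i (gauss_coord j F) = gauss_coord j (gauss_coord i F).
Proof.
move=> mF F0; have [->//|ij] := eqVneq i j.
apply/funext => w; rewrite /gauss_coord.
have H := gauss_int_swap (mvar_upd2 w i j mF) (fun=> F0 _).
apply: (etrans H) => /=.
congr gauss_int; apply/funext => x; congr gauss_int; apply/funext => y.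
by rewrite updC.
Qed.

Lemma gauss_coords_perm s1 s2 F : mvar F -> (forall w, 0 <= F w) ->
  perm_eq s1 s2 -> gauss_coords s1 F = gauss_coords s2 F.
Proof.
move=> mF F0.
have gauss_coord_coords i s G : mvar G -> (forall w, 0 <= G w) ->
    gauss_coord i (gauss_coords s G) = gauss_coords s (gauss_coord i G).
  move=> mG G0; elim: s => //= j s <-; rewrite gauss_coordC//; [exact: mvar_gauss_coords|exact: gauss_coords_ge0].
elim: s1 s2 => [|i s1 IH] s2; first by rewrite perm_sym => /perm_nilP ->.
move=> p; have is2 : i \in s2 by rewrite -(perm_mem p) mem_head.
have [a [b [s2E]]] : exists a b, s2 = a ++ i :: b.
  by case/splitPr: is2 => a b; exists a, b.
have pb : perm_eq s1 (a ++ b).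
  by rewrite -(perm_cons i) (perm_trans p)// s2E perm_catC /= perm_cons perm_catC.
rewrite s2E gauss_coords_cat /= (IH _ pb) gauss_coords_cat gauss_coord_coords//; [exact: mvar_gauss_coords|exact: gauss_coords_ge0].
Qed.

(** Both new values are computed from the old [w]. *)
Definition rot (c s : R) (p q : I) w : I -> R :=
  upd (upd w p (c * w p - s * w q)%R) q (s * w p + c * w q)%R.

Lemma mvar_rot c s p q i : mvar (fun w => rot c s p q w i).
Proof.
move=> d S h mh; rewrite /rot /upd.
case: eqP => _; last case: eqP => _ //.
  by apply: measurable_funD; apply: measurable_funM.
by apply: measurable_funB; apply: measurable_funM.
Qed.

Lemma gauss_coord_rot (c s : R) p q F : (c ^+ 2 + s ^+ 2 = 1)%R -> s != 0%R -> p != q ->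
  mvar F -> (forall w, 0 <= F w) ->
  gauss_coord p (gauss_coord q (fun w => F (rot c s p q w))) = gauss_coord p (gauss_coord q F).
Proof.
move=> cs s0 pq mF F0; apply/funext => w; rewrite /gauss_coord.
have H := gauss_int_rot cs s0 (mvar_upd2 w p q mF) (fun=> F0 _).
apply: (etrans _ H) => /=.
congr gauss_int; apply/funext => x; congr gauss_int; apply/funext => y; congr F.
apply/funext => k; rewrite /rot /upd !eqxx (negPf pq).
by case: eqP => // _; case: eqP.
Qed.

Lemma gauss_coords_rot (c s : R) p q l F : (c ^+ 2 + s ^+ 2 = 1)%R -> s != 0%R -> p != q ->
  uniq l -> p \in l -> q \in l ->
  mvar F -> (forall w, 0 <= F w) ->
  gauss_coords l (fun w => F (rot c s p q w)) = gauss_coords l F.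
Proof.
move=> cs s0 pq ul pl ql mF F0.
(* Reordering makes [p] and [q] the two innermost integrations, where the planar invariance
   applies. *)
have pe : perm_eq l ([seq i <- l | (i != p) && (i != q)] ++ [:: p; q]).
  apply: uniq_perm => //.
    rewrite cat_uniq filter_uniq//= inE pq /= !mem_filter !eqxx/= andbF/=.
    by [].
  move=> i; rewrite mem_cat mem_filter !inE.
  have [->|ip] := eqVneq i p; first by rewrite pl orbT.
  by have [->|iq] := eqVneq i q; rewrite ?ql ?orbT//= orbF.
have mFr : mvar (fun w => F (rot c s p q w)).
  by apply: mvar_comp => // i; exact: mvar_rot.
rewrite (gauss_coords_perm mFr _ pe)// (gauss_coords_perm mF _ pe)// !gauss_coords_cat /=.
by rewrite gauss_coord_rot.
Qed.

Lemma gauss_coords_nneseries s (F : nat -> (I -> R) -> \bar R) :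
  (forall n, mvar (F n)) -> (forall n w, 0 <= F n w) ->
  gauss_coords s (fun w => \sum_(n <oo) F n w) = fun w => \sum_(n <oo) gauss_coords s (F n) w.
Proof.
move=> mF F0; elim: s => //= i s IH.
rewrite IH; apply/funext => w; rewrite /gauss_coord gauss_int_nneseries//.
  by move=> n; apply: mvar_upd; exact: mvar_gauss_coords.
by move=> n x; exact: gauss_coords_ge0.
Qed.

End gauss_iterated.

(** * Factorization of product functions *)

Section gauss_product.
Context {R : realType} {I : eqType}.
Local Notation mR := (measurableTypeR R).
Local Open Scope ereal_scope.

Lemma gauss_coords_prod (s : seq I) (f : I -> mR -> \bar R) (w : I -> R) : uniq s ->
  (forall i, measurable_fun setT (f i)) -> (forall i x, 0 <= f i x) ->
  gauss_coords s (fun w => \prod_(i <- s) f i (w i)) w = \prod_(i <- s) gauss_int (f i).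
Proof.
move=> us mf f0; have mprod (t : seq I) : mvar (fun w : I -> R => \prod_(i <- t) f i (w i)).
  move=> d S h mh; elim: t => [|i t IH].
    by under eq_fun do rewrite big_nil; exact: measurable_cst.
  under eq_fun do rewrite big_cons; apply: emeasurable_funM => //.
  exact: (measurableT_comp (mf i) (mh i)).
have prod0 (t : seq I) (v : I -> R) : 0 <= \prod_(i <- t) f i (v i).
  by rewrite prode_ge0.
elim: s us w => [|i s IH] /= us w; first by rewrite !big_nil.
move: us => /andP[nis us].
rewrite big_cons.
under [X in gauss_coords s X]eq_fun do rewrite big_cons.
rewrite (@gauss_coordsZl _ _ s (fun w => f i (w i)))//; last first.
  by move=> j v x js; rewrite /upd; case: eqP => // ij; rewrite -ij (negPf nis) in js.
rewrite /gauss_coord -[in RHS](IH us w).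
rewrite (_ : (fun x => _) = fun x => (\prod_(j <- s) gauss_int (f j)) * f i x); last first.
  by apply/funext => x; rewrite IH// /upd eqxx muleC.
rewrite gauss_intZl// ?IH// 1?muleC//.
by apply: prode_ge0 => j _; exact: gauss_int_ge0.
Qed.

Lemma gauss_int_indic (B : set mR) :
  gauss_int (fun x => (\1_B x)%:E) = normal_prob 0 1 B.
Proof.
rewrite /normal_prob [RHS]integral_mkcond; apply: eq_integral => x _.
by rewrite patchE indicE; case: ifPn => xB; rewrite /= ?mul1e ?mul0e.
Qed.

End gauss_product.

(** * The joint law of independent standard Gaussians as an iterated integral *)

Section gauss_law.
Context {R : realType} {I : finType}.
Local Notation mR := (measurableTypeR R).
Local Open Scope ereal_scope.

Definition boxset (B : I -> set R) : set (I -> mR) := [set w | forall i, B i (w i)].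

Definition boxes : set (set (I -> mR)) :=
  [set boxset B | B in [set B : I -> set R | forall i, measurable (B i)]].

Local Notation boxT := (g_sigma_algebraType boxes).

Lemma measurable_box d (S : measurableType d) (h : I -> S -> R) :
  (forall i, measurable_fun setT (h i)) ->
  measurable_fun setT (fun s => (fun i => h i s) : boxT).
Proof.
move=> mh; apply: (@measurability _ _ S boxT setT _ boxes) => //.
move=> _ [_ [B mB <-] <-]; rewrite setTI.
rewrite (_ : _ @^-1` _ = \bigcap_(i in setT) (h i @^-1` B i)); last first.
  by apply/seteqP; split => s /=; [move=> H i _; exact: H|move=> H i; exact: (H i)].
apply: fin_bigcap_measurable => // i _.
by rewrite -[X in measurable X]setTI; exact: mh.
Qed.

Lemma measurable_coord i : measurable_fun setT (fun w : boxT => (w : I -> R) i).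
Proof.
move=> _ B mB; rewrite setTI; apply: sub_sigma_algebra.
exists (fun j => if j == i then B else setT).
  by move=> j /=; case: eqP.
apply/seteqP; split => w /=; first by move/(_ i); rewrite eqxx.
by move=> Bwi j; case: eqP => // ->.
Qed.

Lemma mvar_indic (A : set boxT) : measurable A ->
  mvar (fun w : I -> R => (\1_A w : R)%:E).
Proof.
move=> mA d S h mh.
have : measurable_fun setT (fun w : boxT => (\1_A w : R)%:E).
  by apply/measurable_EFinP; exact: measurable_indic.
move=> /measurableT_comp; apply; exact: measurable_box.
Qed.

(** [mvar] is tested on [boxT] itself, with the coordinate maps as the parametrized family. *)
Lemma mvar_measurable (A : set boxT) :
  mvar (fun w : I -> R => (\1_A w : R)%:E) -> measurable A.
Proof.
move=> /(_ _ boxT (fun i w => w i) measurable_coord) m.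
have -> : A = (fun w : boxT => (\1_A w : R)%:E) @^-1` [set 1].
  apply/seteqP; split => w /=; rewrite indicE.
    by move=> Aw; rewrite mem_set.
  by case: (boolP (w \in A)) => [/set_mem//|_ [] /eqP]; rewrite eq_sym oner_eq0.
by rewrite -[X in measurable X]setTI; apply: m => //; exact: emeasurable_set1.
Qed.

(** [w0] supplies the initial values that the integrations overwrite. *)
Definition gauss_box (w0 : I -> R) (A : set boxT) : \bar R :=
  gauss_coords (enum I) (fun w => (\1_A w : R)%:E) w0.

Section gauss_box_measure.
Variable w0 : I -> R.

Let gauss_box0 : gauss_box w0 set0 = 0.
Proof.
rewrite /gauss_box (_ : (fun w => _) = cst 0); last first.
  by apply/funext => w; rewrite indicE in_set0.
by rewrite gauss_coords_id.
Qed.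

Let gauss_box_ge0 A : 0 <= gauss_box w0 A.
Proof. by apply: gauss_coords_ge0 => w; rewrite lee_fin. Qed.

Let gauss_box_sigma_additive : semi_sigma_additive (gauss_box w0).
Proof.
move=> F mF tF mUF; rewrite /gauss_box.
rewrite [X in _ --> gauss_coords _ X _](_ : _ = fun w => \sum_(n <oo) (\1_(F n) w)%:E); last first.
  by apply/funext => w; rewrite indic_bigcup.
rewrite gauss_coords_nneseries; last 2 first.
- by move=> n; exact: mvar_indic.
- by move=> n w; rewrite lee_fin.
apply: is_cvg_nneseries => n _ _; exact: gauss_box_ge0.
Qed.

HB.instance Definition _ := isMeasure.Build _ _ _
  (gauss_box w0) gauss_box0 gauss_box_ge0 gauss_box_sigma_additive.

End gauss_box_measure.

Lemma setI_closed_boxes : setI_closed boxes.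
Proof.
move=> _ _ [A mA <-] [B mB <-]; exists (fun i => A i `&` B i).
  by move=> i /=; apply: measurableI; [exact: mA|exact: mB].
apply/seteqP; split => w /=.
  by move=> AB; split => i; have [] := AB i.
by move=> [wA wB] i; split; [exact: wA|exact: wB].
Qed.

Lemma gauss_boxE (w0 : I -> R) (B : I -> set R) : (forall i, measurable (B i)) ->
  gauss_box w0 (boxset B) = \prod_i normal_prob 0 1 (B i).
Proof.
move=> mB; rewrite /gauss_box.
rewrite (_ : (fun w => _) = fun w => \prod_(i <- enum I) (\1_(B i) (w i))%:E); last first.
  apply/funext => w; rewrite prodEFin; congr EFin; rewrite indicE.
  case: (boolP (w \in boxset B)) => [/set_mem wB|].
    by rewrite big1_seq// => i _; rewrite indicE mem_set.
  rewrite notin_setE => wB.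
  have [i Bi] : exists i, ~ B i (w i) by apply/existsNP.
  by rewrite (bigD1_seq i) ?enum_uniq ?mem_enum//= indicE memNset// mul0r.
rewrite (@gauss_coords_prod _ _ (enum I) (fun i x => (\1_(B i) x)%:E)) ?enum_uniq//.
- by rewrite big_enum /=; apply: eq_bigr => i _; exact: gauss_int_indic.
- move=> i; apply/measurable_EFinP; apply: measurable_indic; exact: mB.
Qed.

(* Both sides are measures agreeing on boxes, a generating pi-system. *)
Lemma gauss_law dT (T : measurableType dT) (P : probability T R)
    (g : I -> T -> R) (A : set (I -> R)) (w0 : I -> R) :
  (forall i, measurable_fun setT (g i)) ->
  (forall i B, measurable B -> P (g i @^-1` B) = normal_prob 0 1 B) ->
  mutually_independent P g ->
  mvar (fun w : I -> R => (\1_A w : R)%:E) ->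
  P [set t | A (fun i => g i t)] = gauss_coords (enum I) (fun w => (\1_A w : R)%:E) w0.
Proof.
move=> mg gN gI mA.
have mG := measurable_box mg.
pose G : T -> boxT := fun t => (fun i => g i t).
rewrite -[RHS]/(gauss_box w0 A) -[LHS]/(pushforward P G A).
apply: (@g_sigma_algebra_measure_unique _ R boxT boxes _ (fun=> setT)) => //.
- exact: sub_sigma_algebra.
- move=> _; exists (fun=> setT) => //.
  by apply/seteqP; split.
- by apply/seteqP; split => // w _; exists 0%N.
- exact: setI_closed_boxes.
- move=> _ [B mB <-]; rewrite /= gauss_boxE// /pushforward.
  have := gI [set: I]%SET B mB.
  rewrite (_ : \bigcap_(i in _) _ = G @^-1` boxset B); last first.
    apply/seteqP; split => t /=; first by move=> H i; apply: (H i); rewrite /= inE.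
    by move=> H i _; exact: H.
  by move=> ->; apply: eq_big => [i|i _]; [rewrite inE|by apply: gN; apply: mB].
- by move=> _; rewrite /= /pushforward preimage_setT probability_setT ltry.
- exact: mvar_measurable.
Qed.

End gauss_law.

(** * Rearrangement for doubly stochastic weights *)

Section sums.
Context {R : realFieldType}.

(** Weights bounded by 1 with prescribed total do best on the largest entries. Since the totals
    agree, a threshold [m] may be subtracted from [b], and then every summand of the difference is
    nonnegative. *)
Lemma sum_threshold_le (d k : nat) (b s : 'I_d -> R) :
  (forall i j : 'I_d, (i <= j)%N -> b j <= b i) ->
  (forall j, 0 <= s j <= 1) -> \sum_j s j = \sum_(j < d | (j < k)%N) 1 ->
  \sum_j s j * b j <= \sum_(j < d | (j < k)%N) b j.
Proof.
move=> bs s01 sk.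
case: (posnP d) => [d0|d0].
  by rewrite !big1// => i; have := ltn_ord i; rewrite {2}d0.
(* The threshold is the last selected entry; the minimum covers [k > d], and [k.-1 = 0] covers
   [k = 0]. *)
have id : (minn k.-1 d.-1 < d)%N by rewrite gtn_min (ltn_predL d) d0 orbT.
pose m := b (Ordinal id).
rewrite -subr_ge0.
have -> : \sum_(j < d | (j < k)%N) b j - \sum_j s j * b j =
   \sum_(j < d) ((j < k)%N%:R - s j) * (b j - m).
  rewrite [in RHS](eq_bigr (fun j : 'I_d => (j < k)%N%:R * b j - s j * b j - ((j < k)%N%:R * m - s j * m))); last first.
    by move=> j _; ring.
  rewrite !sumrB -!mulr_suml sk.
  have E (f : 'I_d -> R) : \sum_(j < d | (j < k)%N) f j = \sum_(j < d) (j < k)%N%:R * f j.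
    by rewrite big_mkcond; apply: eq_bigr => j _; case: ifP; rewrite ?mul1r ?mul0r.
  rewrite !E; under [\sum_j _ * 1]eq_bigr do rewrite mulr1.
  by rewrite subrr subr0.
apply: sumr_ge0 => j _; have /andP[s0 s1] := s01 j.
case: ltnP => jk.
  rewrite mulr_ge0 ?subr_ge0//; apply: bs => /=.
  have k0 : (0 < k)%N by rewrite (leq_ltn_trans _ jk).
  by rewrite leq_min -ltnS prednK// jk /= -ltnS prednK.
rewrite sub0r mulNr -mulrN mulr_ge0// opprB subr_ge0; apply: bs => /=.
by rewrite (leq_trans (geq_minl _ _))// (leq_trans (leq_pred k)).
Qed.

(* Abel summation in [a] reduces to indicators of initial segments, i.e. to
   [sum_threshold_le]. *)
Lemma sum_doubly_stochastic_le (d : nat) (a b : 'I_d -> R) (S : 'I_d -> 'I_d -> R) :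
  (forall i j : 'I_d, (i <= j)%N -> a j <= a i) ->
  (forall i j : 'I_d, (i <= j)%N -> b j <= b i) ->
  (forall i, 0 <= a i) ->
  (forall i j, 0 <= S i j) -> (forall i, \sum_j S i j = 1) -> (forall j, \sum_i S i j = 1) ->
  \sum_i \sum_j S i j * (a i * b j) <= \sum_i a i * b i.
Proof.
move=> sa sb a0 S0 Sr Sc.
(* With the extension by 0, the last increment [D d.-1] is the last entry of [a], nonnegative by
   hypothesis. *)
pose a' (k : nat) := if insub k is Some i then a i else 0.
have a'E (i : 'I_d) : a' i = a i by rewrite /a' valK.
have a'd k : (d <= k)%N -> a' k = 0 by move=> dk; rewrite /a' insubF// ltnNge dk.
pose D k := a' k - a' k.+1.
have D0 k : (k < d)%N -> 0 <= D k.
  move=> kd; rewrite /D subr_ge0 (a'E (Ordinal kd)).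
  have [k1d|k1d] := ltnP k.+1 d; last by rewrite a'd.
  by rewrite (a'E (Ordinal k1d)); apply: sa => /=.
have aE (i : 'I_d) : a i = \sum_(k < d) (i <= k)%N%:R * D k.
  rewrite -a'E (bigID (fun k : 'I_d => (i <= k)%N))/= [X in _ + X]big1 ?addr0; last first.
    by move=> k /negPf ->; rewrite mul0r.
  under eq_bigr => k ik do rewrite ik mul1r.
  rewrite -(big_geq_mkord i d xpredT D).
  have T : \sum_(i <= k < d) D k = - a' d - (- a' i).
    rewrite -(@telescope_sumr _ i d (fun k => - a' k) (ltnW (ltn_ord i))).
    by apply: eq_bigr => k _; rewrite /D opprK addrC.
  by rewrite T (a'd d)// oppr0 add0r opprK.
under eq_bigr => i _.
  under eq_bigr => j _ do rewrite aE mulr_suml mulr_sumr.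
  rewrite exchange_big; over.
rewrite exchange_big /=.
under [X in _ <= X]eq_bigr => i _ do rewrite aE mulr_suml.
rewrite [X in _ <= X]exchange_big /=; apply: ler_sum => k _.
have -> : \sum_(i < d) (i <= k)%N%:R * D k * b i = D k * \sum_(i < d | (i < k.+1)%N) b i.
  rewrite [in RHS]big_mkcond mulr_sumr; apply: eq_bigr => i _.
  by rewrite ltnS; case: leqP => _; rewrite /= ?mulr1n ?mulr0n; ring.
have -> : \sum_(i < d) \sum_(j < d) S i j * ((i <= k)%N%:R * D k * b j) =
   D k * \sum_(j < d) (\sum_(i < d | (i < k.+1)%N) S i j) * b j.
  rewrite exchange_big mulr_sumr; apply: eq_bigr => j _.
  rewrite [in RHS]big_mkcond mulr_suml mulr_sumr; apply: eq_bigr => i _.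
  by rewrite ltnS; case: leqP => _; rewrite /= ?mulr1n ?mulr0n; ring.
apply: ler_wpM2l; first exact: D0.
(* The weights are partial column sums: the full column sums bound them by 1, and the row sums fix
   their total. *)
apply: sum_threshold_le => //.
  move=> j; rewrite sumr_ge0//= -[leRHS](Sc j) [leRHS](bigID (fun i : 'I_d => (i < k.+1)%N))/=.
  by rewrite lerDl sumr_ge0.
by rewrite exchange_big; apply: eq_bigr => i _; exact: Sr.
Qed.

End sums.

(** * The Frobenius inner product, the trace inequality, and perturbation of eigenvectors *)

Section frobenius.
Context {R : realType}.

Definition mxdot (d : nat) (A B : 'M[R]_d) : R := \tr (A *m B^T).

Lemma mxdotE d (A B : 'M[R]_d) : mxdot A B = \sum_i \sum_j A i j * B i j.
Proof.
rewrite /mxdot /mxtrace; apply: eq_bigr => i _; rewrite mxE.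
by apply: eq_bigr => j _; rewrite mxE.
Qed.

Lemma mxdot_ge0 d (A : 'M[R]_d) : 0 <= mxdot A A.
Proof. by rewrite mxdotE; apply: sumr_ge0 => i _; apply: sumr_ge0 => j _; rewrite -expr2 sqr_ge0. Qed.

Lemma frobE d (A : 'M[R]_d) : frob A = Num.sqrt (mxdot A A).
Proof. by rewrite mxdotE. Qed.

Lemma mxdotC d (A B : 'M[R]_d) : mxdot A B = mxdot B A.
Proof. by rewrite !mxdotE; apply: eq_bigr => i _; apply: eq_bigr => j _; rewrite mulrC. Qed.

Lemma mxdotDl d (A B C : 'M[R]_d) : mxdot (A + B) C = mxdot A C + mxdot B C.
Proof. by rewrite /mxdot mulmxDl mxtraceD. Qed.

Lemma mxdotZl d a (A C : 'M[R]_d) : mxdot (a *: A) C = a * mxdot A C.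
Proof. by rewrite /mxdot -scalemxAl mxtraceZ. Qed.

Lemma mxdotDr d (A B C : 'M[R]_d) : mxdot C (A + B) = mxdot C A + mxdot C B.
Proof. by rewrite mxdotC mxdotDl !(mxdotC C). Qed.

Lemma mxdotZr d a (A C : 'M[R]_d) : mxdot C (a *: A) = a * mxdot C A.
Proof. by rewrite mxdotC mxdotZl mxdotC. Qed.

Lemma mxdot_CS d (A B : 'M[R]_d) : mxdot A B <= frob A * frob B.
Proof.
rewrite !frobE; set a := mxdot A A; set b := mxdot B B; set c := mxdot A B.
have a0 : 0 <= a := mxdot_ge0 A. have b0 : 0 <= b := mxdot_ge0 B.
have q (x y : R) : 0 <= x ^+ 2 * a + 2 * (x * y * c) + y ^+ 2 * b.
  have := mxdot_ge0 (x *: A + y *: B).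
  by rewrite !(mxdotDl, mxdotDr, mxdotZl, mxdotZr) (mxdotC B A) -/a -/b -/c; lra.
have [c0|c0] := leP c 0; first by rewrite (le_trans c0)// mulr_ge0.
have cE : c = Num.sqrt (c ^+ 2) by rewrite sqrtr_sqr ger0_norm// ltW.
rewrite -sqrtrM// [leLHS]cE ler_wsqrtr//.
have [b1|b1] := eqVneq b 0.
  (* With [b = 0] the form is affine in its second argument; this choice would give it the value
     [- a - 2]. *)
  have := q 1 (- (a + 1) / c); rewrite b1 mulr0 addr0 expr1n mul1r.
  rewrite (_ : 1 * (- (a + 1) / c) * c = - (a + 1)); first lra.
  by field; rewrite gt_eqF.
have b2 : 0 < b by rewrite lt_neqAle eq_sym b1.
(* Here the form equals [b * (a * b - c ^+ 2)]. *)
have := q b (- c); nra.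
Qed.

Lemma frobD d (A B : 'M[R]_d) : frob (A + B) <= frob A + frob B.
Proof.
have fE (M : 'M[R]_d) : frob M ^+ 2 = mxdot M M by rewrite frobE sqr_sqrtr// mxdot_ge0.
have f0 (M : 'M[R]_d) : 0 <= frob M by rewrite frobE sqrtr_ge0.
rewrite -(@ler_pXn2r _ 2)// ?nnegrE ?addr_ge0// fE.
rewrite !(mxdotDl, mxdotDr) (mxdotC B A) -!fE.
have := mxdot_CS A B; lra.
Qed.

Lemma mxdot_orth d (P A : 'M[R]_d) : P^T *m P = 1%:M ->
  mxdot (P *m A *m P^T) (P *m A *m P^T) = mxdot A A.
Proof.
move=> PP; rewrite /mxdot !trmx_mul trmxK.
have -> : P *m A *m P^T *m (P *m (A^T *m P^T)) = P *m (A *m A^T *m P^T).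
  by rewrite !mulmxA -(mulmxA (P *m A)) PP mulmx1.
by rewrite mxtrace_mulC -(mulmxA _ P^T P) PP mulmx1.
Qed.

Lemma mxdot_diag d (u v : 'rV[R]_d) : mxdot (diag_mx u) (diag_mx v) = \sum_i u 0 i * v 0 i.
Proof.
rewrite mxdotE; apply: eq_bigr => i _; rewrite (bigD1 i)//= big1 ?addr0.
  by rewrite !mxE eqxx !mulr1n.
by move=> j ji; rewrite !mxE eq_sym (negPf ji) !mulr0n mul0r.
Qed.

Definition qform d (W : 'M[R]_d) (v : 'I_d -> R) : R := \sum_i \sum_j v i * W i j * v j.

Lemma mxdot_conj_diag d (P W : 'M[R]_d) (u : 'rV[R]_d) :
  mxdot (P *m diag_mx u *m P^T) W = \sum_k u 0 k * qform W (fun i => P i k).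
Proof.
rewrite mxdotE.
under eq_bigr => i _ do under eq_bigr => j _ do
  (rewrite mxE mulr_suml; under eq_bigr => k _ do rewrite mul_mx_diag !mxE).
under eq_bigr => i _ do rewrite exchange_big /=.
rewrite exchange_big /=; apply: eq_bigr => k _.
rewrite /qform mulr_sumr; apply: eq_bigr => i _; rewrite mulr_sumr; apply: eq_bigr => j _.
by ring.
Qed.

Lemma orth_col d (P : 'M[R]_d) k : P^T *m P = 1%:M -> \sum_i P i k ^+ 2 = 1.
Proof.
move=> /matrixP/(_ k k); rewrite !mxE eqxx mulr1n => <-.
by apply: eq_bigr => i _; rewrite mxE expr2.
Qed.

Lemma qform_conj_diag d (Q : 'M[R]_d) (u : 'rV[R]_d) (v : 'I_d -> R) :
  qform (Q *m diag_mx u *m Q^T) v = \sum_k u 0 k * (\sum_i v i * Q i k) ^+ 2.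
Proof.
rewrite /qform.
under eq_bigr => i _ do under eq_bigr => j _ do
  (rewrite mxE mulr_sumr mulr_suml; under eq_bigr => k _ do rewrite mul_mx_diag !mxE).
under eq_bigr => i _ do rewrite exchange_big /=.
rewrite exchange_big /=; apply: eq_bigr => k _.
rewrite expr2 mulr_suml mulr_sumr; apply: eq_bigr => i _.
by rewrite !mulr_sumr; apply: eq_bigr => j _; ring.
Qed.

(** Von Neumann's inequality: the squared entries of the orthogonal matrix [Q^T *m P] form a doubly
    stochastic matrix. *)
Lemma trace_inequality d (Q P : 'M[R]_d) (u v : 'rV[R]_d) :
  Q *m Q^T = 1%:M -> P *m P^T = 1%:M -> (forall i, 0 <= u 0 i) ->
  (forall i j : 'I_d, (i <= j)%N -> u 0 j <= u 0 i) ->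
  (forall i j : 'I_d, (i <= j)%N -> v 0 j <= v 0 i) ->
  mxdot (Q *m diag_mx u *m Q^T) (P *m diag_mx v *m P^T) <= \sum_i u 0 i * v 0 i.
Proof.
move=> QQ PP u0 su sv; have QQ' := mulmx1C QQ; have PP' := mulmx1C PP.
rewrite mxdot_conj_diag.
under eq_bigr => k _ do rewrite qform_conj_diag mulr_sumr.
rewrite (eq_bigr (fun k => \sum_l (\sum_i Q i k * P i l) ^+ 2 * (u 0 k * v 0 l))); last first.
  by move=> k _; apply: eq_bigr => l _; ring.
have SE k l : \sum_i Q i k * P i l = (Q^T *m P) k l.
  by rewrite mxE; apply: eq_bigr => i _; rewrite mxE.
apply: (@sum_doubly_stochastic_le _ _ (fun i => u 0 i) (fun i => v 0 i)) => //.
- by move=> i j; rewrite sqr_ge0.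
- move=> k; under eq_bigr => l _ do rewrite SE.
  have : (Q^T *m P) *m (Q^T *m P)^T = 1%:M.
    by rewrite trmx_mul trmxK mulmxA -(mulmxA Q^T) PP mulmx1.
  move=> /matrixP/(_ k k); rewrite mxE [RHS]mxE eqxx mulr1n => E; rewrite -[RHS]E.
  by apply: eq_bigr => l _; rewrite [X in _ = _ * X]mxE expr2.
- move=> l; under eq_bigr => k _ do rewrite SE.
  have : (Q^T *m P)^T *m (Q^T *m P) = 1%:M.
    by rewrite trmx_mul trmxK mulmxA -(mulmxA P^T) QQ mulmx1.
  move=> /matrixP/(_ l l); rewrite mxE [RHS]mxE eqxx mulr1n => E; rewrite -[RHS]E.
  by apply: eq_bigr => k _; rewrite [X in _ = X * _]mxE expr2.
Qed.

Lemma eigvec_perturb d (S W Q P : 'M[R]_d) (u v : 'rV[R]_d) (c t : R) :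
  sorted_eigdecomp S Q u -> sorted_eigdecomp (S + c *: W) P v ->
  (forall i, 0 <= u 0 i) -> 0 <= c ->
  (forall z, `|qform W z| <= t * \sum_i z i ^+ 2) ->
  mxdot (P *m diag_mx u *m P^T - S) (P *m diag_mx u *m P^T - S) <= 4 * c * t * \sum_i u 0 i.
Proof.
move=> [QQ [SE su]] [PP [BE sv]] u0 c0 Wt.
have QQ' := mulmx1C QQ; have PP' := mulmx1C PP.
set A := P *m diag_mx u *m P^T.
have AA : mxdot A A = \sum_i u 0 i * u 0 i by rewrite mxdot_orth// mxdot_diag.
have SS : mxdot S S = \sum_i u 0 i * u 0 i by rewrite SE mxdot_orth// mxdot_diag.
(* [A] has the eigenvectors of the perturbed matrix, so for it the trace inequality is an equality;
   comparing with [SB] gives the lower bound on [mxdot A S]. *)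
have AB : mxdot A (S + c *: W) = \sum_i u 0 i * v 0 i.
  rewrite BE mxdot_conj_diag; apply: eq_bigr => k _; congr (_ * _).
  rewrite qform_conj_diag (bigD1 k)//= [X in _ + X]big1 ?addr0.
    rewrite (_ : \sum_i _ = 1) ?expr1n ?mulr1// -(orth_col k PP').
    by apply: eq_bigr => i _; rewrite expr2.
  move=> l lk; have /matrixP/(_ k l) := PP'.
  rewrite !mxE eq_sym (negPf lk) mulr0n => E.
  rewrite (_ : \sum_i _ = 0) ?expr0n ?mulr0// -[RHS]E.
  by apply: eq_bigr => i _; rewrite mxE.
have SB : mxdot S (S + c *: W) <= \sum_i u 0 i * v 0 i.
  by rewrite {1}SE BE; exact: trace_inequality.
have bound (O : 'M[R]_d) : O^T *m O = 1%:M ->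
    `|mxdot (O *m diag_mx u *m O^T) W| <= t * \sum_i u 0 i.
  move=> OO; rewrite mxdot_conj_diag (le_trans (ler_norm_sum _ _ _))// mulr_sumr.
  apply: ler_sum => k _; rewrite normrM ger0_norm// mulrC ler_wpM2r//.
  by rewrite (le_trans (Wt _))// orth_col// mulr1.
have := bound P PP'; rewrite -/A => /ler_normlP[_ bA].
have := bound Q QQ'; rewrite -SE => /ler_normlP[bS _].
have E : mxdot (A - S) (A - S) = mxdot A A + mxdot S S - 2 * mxdot A S.
  rewrite -scaleN1r !(mxdotDl, mxdotDr, mxdotZl, mxdotZr) (mxdotC S A); ring.
rewrite E AA SS {E}.
move: AB SB; rewrite !mxdotDr !mxdotZr SS => AB SB.
have h1 := ler_wpM2l c0 bA; have h2 := ler_wpM2l c0 bS.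
rewrite mulrN in h2.
rewrite -!mulrA; lra.
Qed.

End frobenius.

(** * Quadratic forms and removal of the last row and column *)

Section quadratic.
Import numFieldNormedType.Exports.
Context {R : realType}.
Implicit Types (v x y : nat -> R) (A : nat -> nat -> R) (k : nat).

(** Vectors and matrices are indexed by [nat] and cut off at [k], so that passing from size [k.+1]
    to [k] needs no reindexing. *)
Definition dotp k x y : R := \sum_(i < k) x i * y i.
Definition nrm2 k v : R := \sum_(i < k) v i ^+ 2.
Definition qf k A v : R := \sum_(i < k) \sum_(j < k) v i * A i j * v j.

(* For [x = 0] the quotient is [0]. *)
Definition excess k t x A v : R :=
  `|qf k A v| + dotp k x v ^+ 2 / Num.sqrt (nrm2 k x) - t * nrm2 k v.

(** For [x = 0], the operator norm of the symmetric part of [A] exceeds [t]. For general [x], the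
    rank-one term is what remains of a border already removed. *)
Definition bad k t x A : Prop := exists v, 0 < excess k t x A v.

Lemma nrm2_ge0 k v : 0 <= nrm2 k v.
Proof. by apply: sumr_ge0 => i _; rewrite sqr_ge0. Qed.

Lemma eq_excess k t x A v v' : (forall i, (i < k)%N -> v i = v' i) ->
  excess k t x A v = excess k t x A v'.
Proof.
move=> vv; rewrite /excess /qf /dotp /nrm2.
have vE (i : 'I_k) : v i = v' i by rewrite vv.
congr (`| _ | + _ ^+ 2 / _ - t * _).
- by apply: eq_bigr => i _; apply: eq_bigr => j _; rewrite !vE.
- by apply: eq_bigr => i _; rewrite vE.
- by apply: eq_bigr => i _; rewrite vE.
Qed.

Lemma continuous_sum (n : nat) (f : 'I_n -> R -> R) :
  (forall i, continuous (f i)) -> continuous (fun z => \sum_(i < n) f i z).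
Proof.
move=> cf z; apply: cvg_big => //; first exact: add_continuous.
by move=> i _; exact: cf.
Qed.

Lemma excess_upd_continuous k t x A v i :
  continuous (fun z : R => excess k t x A (upd v i z)).
Proof.
have cu j : continuous (fun z : R => upd v i z j).
  by rewrite /upd; case: eqP => _ z; [exact: cvg_id|exact: cvg_cst].
have c1 : continuous (fun z : R => qf k A (upd v i z)).
  apply: continuous_sum => a; apply: continuous_sum => b z.
  apply: cvgM; last exact: cu.
  by apply: cvgM; [exact: cu|exact: cvg_cst].
have c2 : continuous (fun z : R => dotp k x (upd v i z)).
  by apply: continuous_sum => a z; apply: cvgM; [exact: cvg_cst|exact: cu].
have c3 : continuous (fun z : R => nrm2 k (upd v i z)).
  by apply: continuous_sum => a z; under eq_fun do rewrite expr2; apply: cvgM; exact: cu.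
move=> z; rewrite /excess; apply: cvgB.
  apply: cvgD; first by apply: cvg_norm; exact: c1.
  apply: cvgM; last exact: cvg_cst.
  by under eq_fun do rewrite expr2; rewrite expr2; apply: cvgM; exact: c2.
by apply: cvgM; [exact: cvg_cst|exact: c3].
Qed.

Lemma exists_rat_pos (f : R -> R) z : continuous f -> 0 < f z -> exists q : rat, 0 < f (ratr q).
Proof.
move=> cf fz.
have /nbhs_ballP[e /= e0 He] : \forall y \near z, 0 < f y.
  exact: (cvgr_gt _ (cf z)).
have zz : z < z + e by rewrite ltrDl.
have [q] := rat_in_itvoo zz; rewrite in_itv /= => /andP[q1 q2].
exists q; apply: He; rewrite /ball /= ltr_distlC; apply/andP; split => //.
by rewrite (le_lt_trans _ q1)// gerBl ltW.
Qed.

(* Rational witnesses suffice, which makes [bad] a countable union. *)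
Lemma bad_ratP k t x A :
  bad k t x A <-> exists l : seq rat, 0 < excess k t x A (fun i => ratr (nth 0 l i)).
Proof.
split=> [[v v0]|[l l0]]; last by exists (fun i => ratr (nth 0 l i)).
(* Coordinates are made rational one at a time, so continuity in each variable separately
   suffices. *)
have H n : exists2 v' : nat -> R, 0 < excess k t x A v' &
    exists l : seq rat, size l = n /\ forall i, (i < n)%N -> v' i = ratr (nth 0 l i).
  elim: n => [|n [v' v'0 [l [sl lE]]]]; first by exists v => //; exists [::].
  have v'u : 0 < excess k t x A (upd v' n (v' n)).
    by rewrite (_ : upd _ _ _ = v')//; apply/funext => j; rewrite /upd; case: eqP => // ->.
  have [q q0] := exists_rat_pos (@excess_upd_continuous k t x A v' n) v'u.
  exists (upd v' n (ratr q)) => //; exists (rcons l q); rewrite size_rcons sl; split=> // i.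
  rewrite ltnS leq_eqVlt nth_rcons sl /upd => /orP[/eqP ->|iltn].
    by rewrite ltnn eqxx.
  by rewrite iltn (ltn_eqF iltn) lE.
have [v' v'0 [l [_ lE]]] := H k.
by exists l; rewrite -(eq_excess _ _ _ lE).
Qed.

Lemma measurable_invr : measurable_fun setT (fun z : R => z^-1).
Proof.
rewrite -(setUv [set 0]); apply/measurable_funU => //; first exact: measurableC.
split; first exact: measurable_fun_set1.
apply: open_continuous_measurable_fun; first by rewrite openC; exact: closed_eq.
by move=> z; rewrite inE /= => /eqP z0; exact: inv_continuous.
Qed.

Lemma measurable_bad d (S : measurableType d) k t (x : nat -> S -> R) (A : nat -> nat -> S -> R) :
  (forall i, measurable_fun setT (x i)) -> (forall i j, measurable_fun setT (A i j)) ->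
  measurable [set s | bad k t (x^~ s) (fun i j => A i j s)].
Proof.
move=> mx mA.
rewrite (_ : [set _ | _] = \bigcup_(l in [set: seq rat]) [set s |
   0 < excess k t (x^~ s) (fun i j => A i j s) (fun i => ratr (nth 0 l i))]); last first.
  apply/seteqP; split => s /=; first by move=> /bad_ratP[l l0]; exists l.
  by move=> [l _ l0]; apply/bad_ratP; exists l.
apply: countable_bigcupT_measurable => // l.
set f := fun s => excess k t (x^~ s) (fun i j => A i j s) (fun i => ratr (nth 0 l i)).
have mf : measurable_fun setT f.
  apply: measurable_funB.
    apply: measurable_funD.
      apply: measurableT_comp => //; apply: measurable_sum => i; apply: measurable_sum => j.
      by apply: measurable_funM => //; apply: measurable_funM.
    apply: measurable_funM.
      by apply: measurable_funX; apply: measurable_sum => i; apply: measurable_funM.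
    apply: measurableT_comp; first exact: measurable_invr.
    apply: measurableT_comp; first by apply: continuous_measurable_fun; exact: sqrt_continuous.
    by apply: measurable_sum => i; apply: measurable_funX.
  exact: measurable_cst.
rewrite (_ : [set _ | _] = f @^-1` `]0, +oo[).
  by rewrite -[X in measurable X]setTI; exact: mf.
by apply/seteqP; split => s /=; rewrite in_itv/= andbT.
Qed.

Lemma dotp_rot k c s p q x y : (c ^+ 2 + s ^+ 2 = 1) -> (p < k)%N -> (q < k)%N -> p != q ->
  dotp k (rot c s p q x) (rot c s p q y) = dotp k x y.
Proof.
move=> cs pk qk pq; rewrite /dotp.
have ne : Ordinal qk != Ordinal pk by rewrite -val_eqE /= eq_sym.
rewrite (bigD1 (Ordinal pk))//= (bigD1 (Ordinal qk))//=.
rewrite [RHS](bigD1 (Ordinal pk))//= [X in _ = _ + X](bigD1 (Ordinal qk))//=.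
rewrite [X in _ + (_ + X) = _](eq_bigr (fun i : 'I_k => x i * y i)); last first.
  move=> i /andP[/negPf ip /negPf iq]; rewrite /rot /upd.
  by move: ip iq; rewrite -!val_eqE /= => -> ->.
rewrite !addrA; congr (_ + _); rewrite /rot /upd eqxx (negPf pq) eqxx.
transitivity ((c ^+ 2 + s ^+ 2) * (x p * y p + x q * y q)); first by ring.
by rewrite cs mul1r.
Qed.

Lemma nrm2_dotp k v : nrm2 k v = dotp k v v.
Proof. by apply: eq_bigr => i _; rewrite expr2. Qed.

Lemma qf_dotp k A v : qf k A v = dotp k v (fun a => dotp k (A a) v).
Proof.
rewrite /qf /dotp; apply: eq_bigr => i _; rewrite mulr_sumr.
by apply: eq_bigr => j _; rewrite mulrA.
Qed.

Lemma dotp_rot_lin k c s p q (B : nat -> nat -> R) v a :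
  dotp k (fun b => rot c s p q (B^~ b) a) v = rot c s p q (fun a => dotp k (B a) v) a.
Proof.
rewrite /dotp /rot /upd; case: eqP => _; last case: eqP => _ //.
  by rewrite !mulr_sumr -big_split /=; apply: eq_bigr => i _; ring.
by rewrite !mulr_sumr -sumrB /=; apply: eq_bigr => i _; ring.
Qed.

(** The matrix in the conclusion is [U A U^T] for the plane rotation [U], which acts on the columns
    and then on the rows. *)
Lemma bad_rot k t c s p q x A : (c ^+ 2 + s ^+ 2 = 1) -> (p < k)%N -> (q < k)%N -> p != q ->
  bad k t x A ->
  bad k t (rot c s p q x) (fun a b => rot c s p q (fun b' => rot c s p q (A^~ b') a) b).
Proof.
move=> cs pk qk pq [v v0]; exists (rot c s p q v).
rewrite /excess !nrm2_dotp !dotp_rot// -!nrm2_dotp.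
rewrite (_ : qf _ _ _ = qf k A v)//.
rewrite !qf_dotp -[RHS](dotp_rot v _ cs pk qk pq).
apply: eq_bigr => i _; congr (_ * _); rewrite dotp_rot//.
exact: dotp_rot_lin.
Qed.

Definition bade k t c A : Prop :=
  exists v, 0 < `|qf k.+1 A v| + c * v k ^+ 2 - t * nrm2 k.+1 v.

(** When [x] is a multiple of the last basis vector, the rank-one term only adds [|x|] to the last
    diagonal entry. *)
Lemma bad_lastE k t x A : (forall j, (j < k)%N -> x j = 0) ->
  bad k.+1 t x A -> bade k t (Num.sqrt (nrm2 k.+1 x)) A.
Proof.
move=> x0 [v v0]; exists v; move: v0; rewrite /excess /dotp.
have nE : nrm2 k.+1 x = x k ^+ 2.
  rewrite /nrm2 big_ord_recr /= big1 ?add0r// => i _.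
  by rewrite x0 ?expr0n.
rewrite big_ord_recr /= big1 ?add0r => [|i _]; last by rewrite x0 ?mul0r.
rewrite nE sqrtr_sqr exprMn -(real_normK (num_real (x k))) (_ : _ / _ = `|x k| * v k ^+ 2)//.
have [->|xk] := eqVneq `|x k| 0; first by rewrite invr0 mulr0 mul0r.
by field.
Qed.

(* AM-GM: [2 |v k <x, v>| <= |x| (v k)^2 + <x, v>^2 / |x|]. *)
Lemma bade_split k t c A : bade k t c A ->
  let x j := (A k j + A j k) / 2 in
  t < `|A k k| + Num.sqrt (nrm2 k x) + c \/ bad k t x A.
Proof.
move=> [v v0] x; case: (ltP t (`|A k k| + Num.sqrt (nrm2 k x) + c)) => [|tle]; first by left.
right; exists v; rewrite /excess.
set r := Num.sqrt (nrm2 k x) in tle *.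
have r0 : 0 <= r by rewrite sqrtr_ge0.
(* [A] need not be symmetric: the last row and column enter through their half-sum [x]. *)
have qE : qf k.+1 A v = qf k A v + 2 * v k * dotp k x v + A k k * v k ^+ 2.
  rewrite /qf big_ord_recr /= big_ord_recr /=.
  under eq_bigr => i _ do rewrite big_ord_recr /=.
  rewrite big_split /= -!addrA; congr (_ + _).
  rewrite !addrA -big_split /= /dotp mulr_sumr; congr (_ + _); last by ring.
  by apply: eq_bigr => i _; rewrite /x; field.
have nE : nrm2 k.+1 v = nrm2 k v + v k ^+ 2 by rewrite /nrm2 big_ord_recr.
have cross : `|2 * v k * dotp k x v| <= r * v k ^+ 2 + dotp k x v ^+ 2 / r.
  have [re|rn] := eqVneq r 0.
    have x0 (i : 'I_k) : x i = 0.
      have : nrm2 k x = 0 by apply/eqP; rewrite eq_le nrm2_ge0 andbT -sqrtr_eq0 -/r re.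
      move/eqP; rewrite psumr_eq0; last by move=> j _; rewrite sqr_ge0.
      by move=> /allP/(_ i); rewrite mem_index_enum /= sqrf_eq0 => /(_ isT)/eqP.
    have -> : dotp k x v = 0 by rewrite /dotp big1// => i _; rewrite x0 mul0r.
    by rewrite re mulr0 normr0 expr0n !mul0r addr0.
  have rp : 0 < r by rewrite lt_neqAle eq_sym rn.
  rewrite -subr_ge0 -(@pmulr_lge0 _ r)//.
  have -> : (r * v k ^+ 2 + dotp k x v ^+ 2 / r - `|2 * v k * dotp k x v|) * r =
    (r * `|v k|) ^+ 2 + `|dotp k x v| ^+ 2 - 2 * (r * `|v k|) * `|dotp k x v|.
    rewrite !normrM (ger0_norm (ler0n _ 2)) -(real_normK (num_real (v k))) -(real_normK (num_real (dotp k x v))).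
    by field.
  by have := sqr_ge0 (r * `|v k| - `|dotp k x v|); lra.
have tri : `|qf k.+1 A v| <= `|qf k A v| + `|2 * v k * dotp k x v| + `|A k k| * v k ^+ 2.
  rewrite qE (le_trans (ler_normD _ _))// lerD// ?ler_normD// normrM normrX.
  by rewrite real_normK ?num_real.
move: v0; rewrite nE.
(* The failed first alternative absorbs every term in [v k ^+ 2]; what remains positive is the
   excess of the smaller block. *)
have h : (`|A k k| + r + c) * v k ^+ 2 <= t * v k ^+ 2 by rewrite ler_wpM2r ?sqr_ge0.
lra.
Qed.

End quadratic.

(** * Indicators, conditioning, and simultaneous plane rotations *)

Section pindic.
Context {R : realType}.

Definition pindic (P : Prop) : \bar R := (`[< P >]%:R : R)%:E.

Lemma pindic_ge0 P : (0 <= pindic P)%E.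
Proof. by rewrite lee_fin ler0n. Qed.

Lemma pindic_le P Q : (P -> Q) -> (pindic P <= pindic Q)%E.
Proof.
move=> PQ; rewrite lee_fin ler_nat; case: asboolP => // p.
by rewrite asboolT//; exact: PQ.
Qed.

Lemma pindic_or P Q1 Q2 : (P -> Q1 \/ Q2) -> (pindic P <= pindic Q1 + pindic Q2)%E.
Proof.
move=> PQ; rewrite -EFinD lee_fin -natrD ler_nat; case: asboolP => // /PQ[q|q].
  by rewrite (asboolT q) leq_addr.
by rewrite (asboolT q) leq_addl.
Qed.

Context {I : eqType}.

Lemma mvar_pindic (P : (I -> R) -> Prop) :
  (forall d (S : measurableType d) (h : I -> S -> R),
    (forall i, measurable_fun setT (h i)) -> measurable [set s | P (fun i => h i s)]) ->
  mvar (fun w => pindic (P w)).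
Proof.
move=> mP d S h mh; rewrite /pindic; apply/measurable_EFinP.
have := mP _ _ _ mh => /(@measurable_indic _ _ R setT).
by rewrite (_ : \1__ = fun s => `[< P (fun i => h i s) >]%:R).
Qed.

Lemma mvar_bad k t (x : (I -> R) -> nat -> R) (A : (I -> R) -> nat -> nat -> R) :
  (forall i, mvar (fun w => x w i)) -> (forall i j, mvar (fun w => A w i j)) ->
  mvar (fun w => pindic (bad k t (x w) (A w))).
Proof.
move=> mx mA; apply: mvar_pindic => d S h mh.
apply: (@measurable_bad _ _ _ k t (fun i s => x (fun j => h j s) i)
  (fun i j s => A (fun j => h j s) i j)).
  by move=> i; exact: mx.
by move=> i j; exact: mA.
Qed.

(** Conditioning: a parameter that does not depend on the integrated coordinates may be frozen. *)
Lemma gauss_coords_param {T : Type} (s : seq I) (F : T -> (I -> R) -> \bar R) (a : (I -> R) -> T) w :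
  (forall i w z, i \in s -> a (upd w i z) = a w) ->
  gauss_coords s (fun w' => F (a w') w') w = gauss_coords s (F (a w)) w.
Proof.
elim: s w => //= i s IH w H; rewrite /gauss_coord; congr gauss_int; apply/funext => z.
rewrite IH; first by rewrite H// mem_head.
by move=> j v y js; rewrite H// in_cons js orbT.
Qed.

(** For disjoint pairs this is one rotation applied to all of them at once, as when a matrix is
    multiplied by a plane rotation. *)
Definition acts (c s : R) (ps : seq (I * I)) (w : I -> R) : I -> R :=
  foldr (fun pq => rot c s pq.1 pq.2) w ps.

Lemma mvar_acts c s ps i : mvar (fun w => acts c s ps w i).
Proof.
elim: ps i => [|p ps IH] i /=; first exact: mvar_proj.
have := @mvar_comp _ _ _ _ (fun w => rot c s p.1 p.2 w i) (acts c s ps) IH.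
by apply; exact: mvar_rot.
Qed.

Lemma gauss_coords_acts c s ps (l : seq I) (F : (I -> R) -> \bar R) :
  (c ^+ 2 + s ^+ 2 = 1) -> s != 0 -> uniq l ->
  (forall p, p \in ps -> [/\ p.1 != p.2, p.1 \in l & p.2 \in l]) ->
  mvar F -> (forall w, 0 <= F w)%E ->
  gauss_coords l (fun w => F (acts c s ps w)) = gauss_coords l F.
Proof.
move=> cs s0 ul; elim: ps F => [|p ps IH] F H mF F0 //=.
have [p12 p1 p2] := H p (mem_head _ _).
have mFr : mvar (fun w => F (rot c s p.1 p.2 w)).
  by apply: mvar_comp => // i; exact: mvar_rot.
rewrite (IH (fun w => F (rot c s p.1 p.2 w)))//; first by rewrite gauss_coords_rot.
by move=> q qs; apply: H; rewrite in_cons qs orbT.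
Qed.

Lemma acts_out c s ps w j : j \notin unzip1 ps -> j \notin unzip2 ps -> acts c s ps w j = w j.
Proof.
elim: ps => //= p ps IH; rewrite !inE !negb_or => /andP[j1 j1'] /andP[j2 j2'].
by rewrite /rot /upd (negPf j1) (negPf j2) IH.
Qed.

Lemma acts_in c s ps w p q : uniq (unzip1 ps ++ unzip2 ps) -> (p, q) \in ps ->
  acts c s ps w p = c * w p - s * w q /\ acts c s ps w q = s * w p + c * w q.
Proof.
elim: ps => // -[a b] ps IH /=.
rewrite mem_cat inE !negb_or => /andP[/and3P[a1 ab a2]].
rewrite -cat1s uniq_catCA /= mem_cat negb_or => /andP[/andP[b1 b2] u].
rewrite inE => /orP[/eqP[-> ->]|pqs].
  by rewrite /rot /upd eqxx (negPf ab) eqxx !acts_out.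
have pi : p \in unzip1 ps by apply/mapP; exists (p, q).
have qi : q \in unzip2 ps by apply/mapP; exists (p, q).
have neq (y z : I) (t : seq I) : y \in t -> z \notin t -> y == z = false.
  by move=> yt zt; apply/negbTE/eqP => yz; rewrite -yz yt in zt.
rewrite /rot /upd (neq _ _ _ pi b1) (neq _ _ _ pi a1) (neq _ _ _ qi b2) (neq _ _ _ qi a2).
exact: IH.
Qed.

End pindic.

(** * Rotation invariance of the Gaussian orthogonal ensemble *)

Section goe.
Context {R : realType}.
Local Notation J := (nat + nat * nat)%type.
Implicit Types (w : J -> R) (x v : nat -> R) (k n : nat).

(* Quadratic forms only see the symmetrization of [sqrt 2 * M], which is the
   Gaussian orthogonal ensemble: variance 1 off the diagonal, 2 on it. *)
Definition mat w (i j : nat) : R := Num.sqrt 2 * w (inr (i, j)).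

Fixpoint border_idx k n : seq J :=
  if n is m.+1 then inr (k, m) :: inr (m, k) :: border_idx k m else [::].

(** The order matters: the corner is integrated outermost, then the border, and the smaller block
    innermost with both held fixed. *)
Fixpoint square_idx k : seq J :=
  if k is m.+1 then inr (m, m) :: border_idx m m ++ square_idx m else [::].

Lemma mem_border_idx_inr k n a b : (inr (a, b) \in border_idx k n) = ((a == k) && (b < n) || (b == k) && (a < n))%N.
Proof.
elim: n => [|n IH] /=; first by rewrite !ltn0 !andbF.
rewrite !inE IH !ltnS (leq_eqVlt a n) (leq_eqVlt b n).
rewrite (_ : (inr (a, b) == inr (k, n) :> J) = (a == k) && (b == n))//.
rewrite (_ : (inr (a, b) == inr (n, k) :> J) = (a == n) && (b == k))//.
by case: (a == k); case: (b == n); case: (a == n); case: (b == k); rewrite /= ?orbT ?orbF.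
Qed.

Lemma mem_border_idx_inl k n i : (inl i \in border_idx k n) = false.
Proof. by elim: n => //= n IH; rewrite !inE IH. Qed.

Lemma mem_square_idx_inl k i : (inl i \in square_idx k) = false.
Proof. by elim: k => //= k IH; rewrite inE mem_cat mem_border_idx_inl IH. Qed.

Lemma mem_square_idx_inr k a b : (inr (a, b) \in square_idx k) = ((a < k) && (b < k))%N.
Proof.
elim: k => //= k IH; rewrite inE mem_cat mem_border_idx_inr IH.
rewrite (_ : (inr (a, b) == inr (k, k) :> J) = (a == k) && (b == k))//.
rewrite !ltnS (leq_eqVlt a k) (leq_eqVlt b k).
by case: (a == k); case: (b == k); case: (a < k)%N; case: (b < k)%N.
Qed.

Lemma uniq_border_idx k n : (n <= k)%N -> uniq (border_idx k n).
Proof.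
elim: n => //= n IH nk; rewrite !inE !mem_border_idx_inr (IH (ltnW nk)) !ltnn.
rewrite (_ : (inr (k, n) == inr (n, k) :> J) = (k == n) && (n == k))//.
by rewrite (ltn_eqF nk) (gtn_eqF nk) !andbF.
Qed.

Lemma uniq_square_idx k : uniq (square_idx k).
Proof.
elim: k => //= k IH; rewrite mem_cat mem_border_idx_inr mem_square_idx_inr ltnn !andbF /=.
rewrite cat_uniq uniq_border_idx//= IH andbT; apply/hasPn => -[i|[a b]].
  by rewrite mem_square_idx_inl.
rewrite mem_square_idx_inr /= mem_border_idx_inr => /andP[ak bk].
by rewrite (ltn_eqF ak) (ltn_eqF bk).
Qed.

Lemma eq_bad k t x (A A' : nat -> nat -> R) :
  (forall i j, (i < k)%N -> (j < k)%N -> A i j = A' i j) -> bad k t x A -> bad k t x A'.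
Proof.
move=> AA [v v0]; exists v; move: v0; rewrite /excess.
rewrite (_ : qf k A v = qf k A' v)//; apply: eq_bigr => i _; apply: eq_bigr => j _.
by rewrite AA.
Qed.

Lemma mvar_mat i j : mvar (fun w => mat w i j).
Proof. by move=> d S h mh; apply: measurable_funM. Qed.

Local Open Scope ereal_scope.

Definition pbad k t x w : \bar R := gauss_coords (square_idx k) (fun w => pindic (bad k t x (mat w))) w.

Lemma mvar_pindic_mat k t x : mvar (fun w => pindic (bad k t x (mat w)) : \bar R).
Proof.
apply: (@mvar_bad _ _ k t (fun=> x) mat) => [i d S h _|i j]; first exact: measurable_cst.
exact: mvar_mat.
Qed.

(* [M |-> U M U^T] preserves the law of [M] and maps a witness [v] to [U v]. *)
Lemma pbad_rot_le k t c s p q x w : (c ^+ 2 + s ^+ 2 = 1)%R -> s != 0%R ->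
  (p < k)%N -> (q < k)%N -> p != q ->
  pbad k t x w <= pbad k t (rot c s p q x) w.
Proof.
move=> cs s0 pk qk pq; rewrite /pbad.
(* [cols] rotates every column, giving [U M]; [rows] rotates every row, giving [M U^T]. Each list
   consists of disjoint pairs of entries. *)
pose cols : seq (J * J) := [seq (inr (p, l), inr (q, l)) | l <- iota 0 k].
pose rows : seq (J * J) := [seq (inr (l, p), inr (l, q)) | l <- iota 0 k].
have pq1 l l' : (inr (p, l) == inr (q, l') :> J) = false.
  by apply/negbTE/eqP => -[E _]; rewrite E eqxx in pq.
have pq2 l l' : (inr (l, p) == inr (l', q) :> J) = false.
  by apply/negbTE/eqP => -[_ E]; rewrite E eqxx in pq.
have Hc : forall y, y \in cols -> [/\ y.1 != y.2, y.1 \in square_idx k & y.2 \in square_idx k].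
  move=> y /mapP[l]; rewrite mem_iota add0n => /andP[_ lk] -> /=.
  by rewrite pq1 !mem_square_idx_inr pk qk lk.
have Hr : forall y, y \in rows -> [/\ y.1 != y.2, y.1 \in square_idx k & y.2 \in square_idx k].
  move=> y /mapP[l]; rewrite mem_iota add0n => /andP[_ lk] -> /=.
  by rewrite pq2 !mem_square_idx_inr pk qk lk.
have uc : uniq (unzip1 cols ++ unzip2 cols).
  rewrite cat_uniq /unzip1 /unzip2 -!map_comp !map_inj_uniq ?iota_uniq//= ?andbT; last 2 first.
  - by move=> a b [].
  - by move=> a b [].
  apply/hasPn => _ /mapP[l _ ->]; apply/mapP => -[l' _ /= /esym/eqP].
  by rewrite pq1.
have ur : uniq (unzip1 rows ++ unzip2 rows).
  rewrite cat_uniq /unzip1 /unzip2 -!map_comp !map_inj_uniq ?iota_uniq//= ?andbT; last 2 first.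
  - by move=> a b [].
  - by move=> a b [].
  apply/hasPn => _ /mapP[l _ ->]; apply/mapP => -[l' _ /= /esym/eqP].
  by rewrite pq2.
set F := fun w => pindic (bad k t (rot c s p q x) (mat w)).
have mF : mvar F by exact: mvar_pindic_mat.
have F0 (u : J -> R) : 0 <= F u by exact: pindic_ge0.
have mFr : mvar (fun w => F (acts c s rows w)).
  by apply: mvar_comp => // i; exact: mvar_acts.
rewrite -(gauss_coords_acts cs s0 (uniq_square_idx k) Hr mF F0).
rewrite -(gauss_coords_acts cs s0 (uniq_square_idx k) Hc mFr (fun=> F0 _)).
apply: gauss_coords_le => [||v|v]; [exact: mvar_pindic_mat| |exact: pindic_ge0|].
  by apply: (@mvar_comp _ _ _ _ (fun w => F (acts c s rows w))) => // i; exact: mvar_acts.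
apply: pindic_le => /(bad_rot cs pk qk pq); apply: eq_bad => a b ak bk.
have colE a' b' : (b' < k)%N -> acts c s cols v (inr (a', b')) =
    rot c s p q (fun a => v (inr (a, b'))) a'.
  move=> b'k; have pqin : (inr (p, b'), inr (q, b')) \in cols.
    by apply/mapP; exists b' => //; rewrite mem_iota add0n.
  have [Ep Eq] := acts_in c s v uc pqin.
  rewrite /rot /upd; have [->//|aq] := eqVneq a' q; have [->//|ap] := eqVneq a' p.
  by rewrite acts_out//; apply/mapP => -[_ /mapP[l _ ->]] /= [E]; rewrite E eqxx in ap aq.
have rowE : acts c s rows (acts c s cols v) (inr (a, b)) =
    rot c s p q (fun b => acts c s cols v (inr (a, b))) b.
  have pqin : (inr (a, p), inr (a, q)) \in rows.
    by apply/mapP; exists a => //; rewrite mem_iota add0n.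
  have [Ep Eq] := acts_in c s (acts c s cols v) ur pqin.
  rewrite /rot /upd; have [->//|aq] := eqVneq b q; have [->//|ap] := eqVneq b p.
  by rewrite acts_out//; apply/mapP => -[_ /mapP[l _ ->]] /= [_ E]; rewrite E eqxx in ap aq.
rewrite /mat rowE.
have rotZ (f : nat -> R) y : (rot c s p q (fun z => Num.sqrt 2 * f z) y = Num.sqrt 2 * rot c s p q f y)%R.
  by rewrite /rot /upd; case: eqP => _; [ring|case: eqP => _ //; ring].
rewrite -rotZ /rot /upd -/(rot c s p q _ _).
by case: eqP => _; [|case: eqP => _]; rewrite !colE// -!rotZ.
Qed.

(** Rotations in the planes [(n, k)], [n < k], clear the entries of [x] one by one and collect its
    norm in the last entry. *)
Lemma pbad_last k t x : exists x', [/\ (forall j, (j < k)%N -> x' j = 0%R),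
  nrm2 k.+1 x' = nrm2 k.+1 x & forall w, pbad k.+1 t x w <= pbad k.+1 t x' w].
Proof.
suff H n : (n <= k)%N -> exists x', [/\ (forall j, (j < n)%N -> x' j = 0%R),
    nrm2 k.+1 x' = nrm2 k.+1 x & forall w, pbad k.+1 t x w <= pbad k.+1 t x' w].
  exact: H.
elim: n => [|n IH] nk; first by exists x.
have [x' [x'0 x'n x'b]] := IH (ltnW nk).
(* An entry that already vanishes is skipped, as its rotation would have sine 0, which [pbad_rot_le]
   excludes. *)
have [xn0|xn0] := eqVneq (x' n) 0%R.
  by exists x'; split=> // j; rewrite ltnS leq_eqVlt => /orP[/eqP ->//|]; exact: x'0.
pose r := Num.sqrt (x' n ^+ 2 + x' k ^+ 2).
have r20 : (0 < x' n ^+ 2 + x' k ^+ 2)%R.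
  by rewrite ltr_pwDl ?sqr_ge0// lt_neqAle sqr_ge0 eq_sym sqrf_eq0 xn0.
have r0 : (0 < r)%R by rewrite sqrtr_gt0.
have r2 : (r ^+ 2 = x' n ^+ 2 + x' k ^+ 2)%R by rewrite sqr_sqrtr// ltW.
have cs : ((x' k / r) ^+ 2 + (x' n / r) ^+ 2 = 1)%R.
  by rewrite !expr_div_n -mulrDl addrC -r2 divff// gt_eqF// exprn_gt0.
have s0 : (x' n / r != 0)%R by rewrite mulf_neq0// invr_neq0// gt_eqF.
have nek : n != k by rewrite ltn_eqF.
exists (rot (x' k / r) (x' n / r) n k x'); split.
- move=> j; rewrite ltnS => jn; rewrite /rot /upd.
  rewrite ltn_eqF; last exact: leq_ltn_trans nk.
  move: jn; rewrite leq_eqVlt => /orP[/eqP ->|jn]; last by rewrite (ltn_eqF jn) x'0.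
  by rewrite eqxx; ring.
- by rewrite nrm2_dotp dotp_rot// ?ltnS 1?ltnW// -nrm2_dotp.
- move=> w; rewrite (le_trans (x'b w))//.
  by apply: pbad_rot_le => //; rewrite ltnS ltnW.
Qed.

End goe.

(** * Exponential moments of the corner and the border *)

Section chi.
Context {R : realType}.
Local Notation mR := (measurableTypeR R).
Local Notation J := (nat + nat * nat)%type.

Lemma gauss_int_expR_norm (a : R) : 0 <= a ->
  (gauss_int (fun x => (expR (a * `|x|))%:E) <= (2 * expR (a ^+ 2 / 2))%:E)%E.
Proof.
move=> a0.
have me (b : R) : measurable_fun setT (fun x : mR => (expR (b * x))%:E).
  by apply/measurable_EFinP; apply: measurableT_comp => //; apply: measurable_funM.
apply: (@le_trans _ _ (gauss_int (fun x => (expR (a * x))%:E + (expR (- a * x))%:E)%E)).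
  apply: gauss_int_le => //.
  - apply/measurable_EFinP; apply: measurableT_comp => //; apply: measurable_funM => //.
  - by apply: emeasurable_funD.
  - move=> x; rewrite -EFinD lee_fin; have [x0|x0] := leP 0 x.
      by rewrite ger0_norm// lerDl expR_ge0.
    by rewrite ltr0_norm// mulrN -mulNr lerDr expR_ge0.
rewrite gauss_intD//.
by rewrite !gauss_int_expR sqrrN -EFinD lee_fin mulr2n mulrDl !mul1r.
Qed.

(** The combination is [(x + y) / sqrt 2], which a rotation by 45 degrees makes a single
    coordinate. *)
Lemma gauss_int2_expR_sqr (a : R) : a < 1 / 2 ->
  gauss_int (fun x => gauss_int (fun y => (expR (a * ((Num.sqrt 2 * x + Num.sqrt 2 * y) / 2) ^+ 2))%:E))
  = ((Num.sqrt (1 - 2 * a))^-1)%:E.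
Proof.
move=> a12; pose c : R := Num.sqrt 2 / 2.
have s20 : (0 : R) < Num.sqrt 2 by rewrite sqrtr_gt0.
have s2 : (Num.sqrt 2 : R) ^+ 2 = 2 by rewrite sqr_sqrtr.
have cs : c ^+ 2 + c ^+ 2 = 1 by rewrite /c expr_div_n s2; field.
have c0 : c != 0 by rewrite mulf_neq0// ?gt_eqF// invr_gt0.
have mf : measurable_fun setT (fun z : mR * mR => (expR (a * (z.2 : R) ^+ 2))%:E).
  apply/measurable_EFinP; apply: measurableT_comp => //; apply: measurable_funM => //.
  by apply: measurable_funX; exact: measurable_snd.
have f0 (z : mR * mR) : (0 <= (expR (a * (z.2 : R) ^+ 2))%:E)%E by rewrite lee_fin expR_ge0.
have := gauss_int_rot cs c0 mf f0 => /= H.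
rewrite -(gauss_int_expR_sqr a12) -[RHS]gauss_int_cst; last first.
  by apply: gauss_int_ge0 => x; rewrite lee_fin expR_ge0.
rewrite -[RHS]H; congr gauss_int; apply/funext => x; congr gauss_int; apply/funext => y.
by congr (expR (a * _ ^+ 2))%:E; rewrite /c; ring.
Qed.

(** The vector [x] of [bade_split] for [A = mat w]. *)
Definition border_vec (k : nat) (w : J -> R) (j : nat) : R := (mat w k j + mat w j k) / 2.

Lemma mvar_nrm2_border_vec n k : mvar (fun w => nrm2 n (border_vec k w)).
Proof.
move=> d S h mh; apply: measurable_sum => i; apply: measurable_funX.
by apply: measurable_funM => //; apply: measurable_funD; apply: measurable_funM.
Qed.

Lemma mvar_expR {I : eqType} (f : (I -> R) -> R) : mvar f -> mvar (fun w => (expR (f w))%:E).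
Proof.
by move=> mf d S h mh; apply/measurable_EFinP; apply: measurableT_comp => //; exact: mf.
Qed.

Lemma mvar_gt {I : eqType} (f : (I -> R) -> R) t : mvar f -> mvar (fun w => pindic (t < f w) : \bar R).
Proof.
move=> mf; apply: mvar_pindic => d S h mh.
have := mf _ _ _ mh measurableT `]t, +oo[%classic (measurable_itv _); rewrite setTI.
by congr measurable; apply/seteqP; split => s /=; rewrite in_itv/= andbT.
Qed.

Lemma mvarM {I : eqType} (f g : (I -> R) -> R) : mvar f -> mvar g -> mvar (fun w => f w * g w).
Proof. by move=> mf mg d S h mh; apply: measurable_funM; [exact: mf|exact: mg]. Qed.

Lemma mvarD {I : eqType} (f g : (I -> R) -> R) : mvar f -> mvar g -> mvar (fun w => f w + g w).
Proof. by move=> mf mg d S h mh; apply: measurable_funD; [exact: mf|exact: mg]. Qed.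

Lemma mvar_cst {I : eqType} dU (U : sigmaRingType dU) (c : U) :
  mvar (fun _ : I -> R => c).
Proof. by move=> d S h mh; exact: measurable_cst. Qed.

(** The moment generating function of a chi-square variable: each border coordinate is standard
    normal and uses its own two entries of [M]. *)
Lemma gauss_coords_border_expR (a : R) k n w : a < 1 / 2 -> (n <= k)%N ->
  gauss_coords (border_idx k n) (fun w => (expR (a * nrm2 n (border_vec k w)))%:E) w =
  ((Num.sqrt (1 - 2 * a))^-1 ^+ n)%:E.
Proof.
move=> a12; set kap := (_^-1 : R).
have kap0 : 0 <= kap by rewrite invr_ge0.
elim: n w => [|n IH] w nk /=.
  by rewrite /nrm2 big_ord0 mulr0 expR0.
have nek : (inr (k, n) == inr (n, k) :> J) = false.
  by apply/negbTE/eqP => -[E _]; rewrite E ltnn in nk.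
have -> : (fun w => (expR (a * nrm2 n.+1 (border_vec k w)))%:E) =
    (fun w => (expR (a * border_vec k w n ^+ 2))%:E * (expR (a * nrm2 n (border_vec k w)))%:E)%E.
  by apply/funext => v; rewrite /nrm2 big_ord_recr /= mulrDr expRD mulrC.
rewrite gauss_coordsZl; last first.
- move=> [i|[b b']] v z; first by rewrite mem_border_idx_inl.
  rewrite mem_border_idx_inr => H; congr (expR (a * _ ^+ 2))%:E; rewrite /border_vec /mat /upd.
  rewrite (_ : (inr (k, n) == inr (b, b') :> J) = (k == b) && (n == b'))//.
  rewrite (_ : (inr (n, k) == inr (b, b') :> J) = (n == b) && (k == b'))//.
  suff [-> ->] : ((k == b) && (n == b') = false) /\ ((n == b) && (k == b') = false) by [].
  split; apply/negbTE/negP => /andP[/eqP E1 /eqP E2]; move: H; rewrite -E1 -E2 !ltnn ?andbF /=.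
    by rewrite (ltn_eqF nk).
  by rewrite orbF (ltn_eqF nk).
- by move=> v; rewrite lee_fin expR_ge0.
- by move=> v; rewrite lee_fin expR_ge0.
- by apply: mvar_expR; apply: mvarM; [exact: mvar_cst|exact: mvar_nrm2_border_vec].
rewrite /gauss_coord.
transitivity (gauss_int (fun x => gauss_int (fun y => (kap ^+ n)%:E *
   (expR (a * ((Num.sqrt 2 * x + Num.sqrt 2 * y) / 2) ^+ 2))%:E)%E)).
  congr gauss_int; apply/funext => x; congr gauss_int; apply/funext => y.
  rewrite IH 1?ltnW// muleC; congr (_ * (expR (a * _ ^+ 2))%:E)%E.
  by rewrite /border_vec /mat /upd eqxx nek eqxx.
have mx x : measurable_fun setT (fun y : mR =>
    (expR (a * ((Num.sqrt 2 * x + Num.sqrt 2 * y) / 2) ^+ 2))%:E).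
  apply/measurable_EFinP; apply: measurableT_comp => //; apply: measurable_funM => //.
  apply: measurable_funX; apply: measurable_funM => //.
  by apply: measurable_funD; [exact: measurable_cst|apply: measurable_funM].
have e0 (x y : R) : (0 <= (expR (a * ((Num.sqrt 2 * x + Num.sqrt 2 * y) / 2) ^+ 2))%:E)%E.
  by rewrite lee_fin expR_ge0.
under [X in gauss_int X]eq_fun => x.
  rewrite gauss_intZl ?lee_fin ?exprn_ge0//.
  over.
rewrite gauss_intZl ?lee_fin ?exprn_ge0//.
- by rewrite gauss_int2_expR_sqr// -EFinM -exprSr.
- apply: (@measurable_gauss_int2 _ _ mR (fun z : mR * mR =>
   (expR (a * ((Num.sqrt 2 * z.1 + Num.sqrt 2 * z.2) / 2) ^+ 2))%:E)) => //.
  apply/measurable_EFinP; apply: measurableT_comp => //; apply: measurable_funM => //.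
  apply: measurable_funX; apply: measurable_funM => //; exact: measurable_lin2.
- by move=> x; apply: gauss_int_ge0 => y.
Qed.

End chi.

(** * The recursive tail bound for the orthogonal ensemble *)

Section goe_bound.
Context {R : realType}.
Local Notation J := (nat + nat * nat)%type.
Variables (d : nat) (th t : R).
Hypotheses (d0 : (0 < d)%N) (th0 : 0 < th).

Let sd : R := Num.sqrt d%:R.
Let al : R := th / (2 * (sd + th)).
Let B0 : R := expR (th * (sd + th) / 2).
Let kap : R := (Num.sqrt (1 - 2 * al))^-1.
(** Bounds [E exp (th chi_k)] uniformly in [k <= d]. *)
Definition goeC : R := expR (th * sd + th ^+ 2 / 2).
(** Bounds [E exp (th (|a| - t))] for a diagonal entry [a] of variance 2; the factor 2 comes from
    the absolute value. *)
Definition goeD : R := 2 * expR (th ^+ 2 - th * t).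

Let sd0 : 0 < sd. Proof. by rewrite sqrtr_gt0 ltr0n. Qed.

Let al12 : al < 1 / 2.
Proof. rewrite /al ltr_pdivrMr; have := sd0; have := th0; lra. Qed.

Let alE : 1 - 2 * al = sd / (sd + th).
Proof. by rewrite /al; field; rewrite gt_eqF// addr_gt0. Qed.

Let kap2 : kap ^+ 2 = 1 + th / sd.
Proof.
rewrite /kap exprVn sqr_sqrtr alE; last by rewrite divr_ge0 ?ltW// addr_gt0.
by field; rewrite !gt_eqF// addr_gt0.
Qed.

Let kap1 : 1 <= kap.
Proof.
rewrite -(@ler_pXn2r _ 2)// ?nnegrE ?invr_ge0 ?sqrtr_ge0// kap2 expr1n lerDl.
by rewrite divr_ge0// ltW.
Qed.

(** From [kap ^+ 2 = 1 + th / sd <= exp (th / sd)] one gets [kap ^+ d <= exp (th * sd / 2)], which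
    completes the exponent of [B0] to that of [goeC]. *)
Lemma chi_const k : (k <= d)%N -> B0 * kap ^+ k <= goeC.
Proof.
move=> kd; apply: (@le_trans _ _ (B0 * kap ^+ d)).
  by rewrite ler_wpM2l ?expR_ge0// ler_weXn2l.
have kape : kap <= expR (th / (2 * sd)).
  rewrite -(@ler_pXn2r _ 2)//; [|by rewrite nnegrE (le_trans ler01)|by rewrite nnegrE expR_ge0].
  rewrite kap2.
  rewrite -expRM_natl (_ : 2%:R * (th / (2 * sd)) = th / sd) ?expR_ge1Dx//.
  by field; rewrite gt_eqF.
have : kap ^+ d <= expR (th * sd / 2).
  rewrite (_ : th * sd / 2 = d%:R * (th / (2 * sd))); last first.
    have dE : d%:R = sd ^+ 2 by rewrite sqr_sqrtr// ler0n.
    by rewrite dE; field; rewrite gt_eqF.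
  by rewrite expRM_natl lerXn2r// ?nnegrE ?expR_ge0// (le_trans ler01).
move=> /(ler_wpM2l (expR_ge0 (th * (sd + th) / 2))) /le_trans; apply.
by rewrite -expRD ler_expR le_eqVlt; apply/orP; left; apply/eqP; field.
Qed.

(* [B0] and [al] are those of the tangent parabola to [r |-> th * r] at
   [r = sd + th]. *)
Lemma expR_chi r : expR (th * r) <= B0 * expR (al * r ^+ 2).
Proof.
rewrite /B0 -expRD ler_expR -subr_ge0.
have -> : th * (sd + th) / 2 + al * r ^+ 2 - th * r =
   al * (r - (sd + th)) ^+ 2.
  by rewrite /al; field; rewrite gt_eqF// addr_gt0.
by rewrite mulr_ge0 ?sqr_ge0// divr_ge0 ?ltW// mulr_gt0// addr_gt0.
Qed.

Local Open Scope ereal_scope.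

Lemma pbad0 x w : pbad 0 t x w = 0.
Proof.
rewrite /pbad /= /pindic asboolF// => -[v]; rewrite /excess /qf /dotp /nrm2 !big_ord0.
by rewrite normr0 expr0n /= mul0r mulr0 subr0 addr0 ltxx.
Qed.

Let K1 (k : nat) (c : R) (w : J -> R) : R :=
  (expR (th * (c - t)) * B0 * expR (th * `|mat w k k|) + goeD * goeC * B0)%R.

(** The event splits by [bade_split]. A large corner and border cost [goeD * goeC * exp (th c)] by
    Chernoff; for the smaller block, averaging the inductive bound over the new border turns its
    exponential into one more [goeC]. *)
Lemma pbad_step k c x w : (k < d)%N -> (0 <= c)%R ->
  (forall x w, pbad k t x w <=
     (goeD * goeC * (goeC * k%:R + expR (th * Num.sqrt (nrm2 k x))))%:E) ->
  (forall j, (j < k)%N -> x j = 0%R) -> c = Num.sqrt (nrm2 k.+1 x) ->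
  pbad k.+1 t x w <= (goeD * goeC * (goeC * k.+1%:R + expR (th * c)))%:E.
Proof.
move=> kd c0 IH x0 cE.
have DC0 : (0 <= goeD * goeC)%R by rewrite !mulr_ge0 ?expR_ge0.
have mabs : mvar (fun w : J -> R => `|mat w k k|%R).
  by move=> d' S h mh; apply: measurableT_comp => //; exact: mvar_mat.
have msq : mvar (fun w : J -> R => Num.sqrt (nrm2 k (border_vec k w))).
  move=> d' S h mh; apply: measurableT_comp; last exact: mvar_nrm2_border_vec.
  by apply: continuous_measurable_fun; exact: sqrt_continuous.
pose ib1 (w : J -> R) : \bar R := pindic (t < `|mat w k k| + Num.sqrt (nrm2 k (border_vec k w)) + c)%R.
pose ib2 (w : J -> R) : \bar R := pindic (bad k t (border_vec k w) (mat w)).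
have mib1 : mvar ib1.
  by apply: mvar_gt; apply: mvarD; [exact: mvarD|exact: mvar_cst].
have mib2 : mvar ib2.
  apply: mvar_bad => [i|i j]; last exact: mvar_mat.
  by move=> d' S h mh; apply: measurable_funM => //; apply: measurable_funD; exact: mvar_mat.
(* [H] bounds the conditional probability given corner and border. Replacing [exp (th |x|)] by the
   parabola bound of [expR_chi] makes the border integral explicit. *)
pose H (w : J -> R) : \bar R := (K1 k c w)%:E * (expR (al * nrm2 k (border_vec k w)))%:E
   + (goeD * goeC * (goeC * k%:R))%:E.
have K10 w' : (0 <= K1 k c w')%R by rewrite addr_ge0 ?mulr_ge0 ?expR_ge0.
have mK1 : mvar (K1 k c).
  apply: mvarD; last exact: mvar_cst.
  apply: mvarM; first exact: mvar_cst.
  move=> d' S h mh; apply: measurableT_comp => //; apply: measurable_funM => //.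
  exact: mabs.
have mE : mvar (fun w : J -> R => (expR (al * nrm2 k (border_vec k w)))%:E).
  by apply: mvar_expR; apply: mvarM; [exact: mvar_cst|exact: mvar_nrm2_border_vec].
have mKE : mvar (fun w : J -> R => (K1 k c w)%:E * (expR (al * nrm2 k (border_vec k w)))%:E).
  move=> d' S h mh; apply: emeasurable_funM; last exact: mE.
  by apply/measurable_EFinP; exact: mK1.
have mH : mvar H.
  by move=> d' S h mh; apply: emeasurable_funD => //; exact: mKE.
have E0 (w' : J -> R) : 0 <= (expR (al * nrm2 k (border_vec k w')))%:E by rewrite lee_fin expR_ge0.
have cst0 : 0 <= (goeD * goeC * (goeC * k%:R))%:E.
  by rewrite lee_fin !mulr_ge0 ?expR_ge0.
have H0 w' : 0 <= H w' by rewrite adde_ge0// mule_ge0// lee_fin.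
have inner w' : gauss_coords (square_idx k) (fun w => ib1 w + ib2 w) w' <= H w'.
  rewrite gauss_coordsD//; [|by move=> v; exact: pindic_ge0|by move=> v; exact: pindic_ge0].
  have indep (i : J) (v : J -> R) (z : R) : i \in square_idx k ->
      border_vec k (upd v i z) = border_vec k v /\ mat (upd v i z) k k = mat v k k.
    case: i => [i|[a b]]; first by rewrite mem_square_idx_inl.
    rewrite mem_square_idx_inr => /andP[ak bk].
    have ne1 j : (inr (k, j) == inr (a, b) :> J) = false.
      by apply/negbTE/eqP => -[E _]; rewrite E ltnn in ak.
    have ne2 j : (inr (j, k) == inr (a, b) :> J) = false.
      by apply/negbTE/eqP => -[_ E]; rewrite E ltnn in bk.
    split; last by rewrite /mat /upd ne1.
    by apply/funext => j; rewrite /border_vec /mat /upd ne1 ne2.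
  rewrite gauss_coords_id; [|by move=> v; exact: pindic_ge0|]; last first.
    by move=> i v z ik; rewrite /ib1; have [-> ->] := indep i v z ik.
  rewrite (@gauss_coords_param _ _ _ (square_idx k) (fun x w => pindic (bad k t x (mat w))) (border_vec k)); last first.
    by move=> i v z ik; have [] := indep i v z ik.
  apply: le_trans (leeD2l _ (IH (border_vec k w') w')) _.
  (* Chernoff: the indicator of a positive quantity is at most its exponential. *)
  apply: (@le_trans _ _ ((expR (th * (`|mat w' k k| + Num.sqrt (nrm2 k (border_vec k w')) + c - t)))%:E +
     (goeD * goeC * (goeC * k%:R + expR (th * Num.sqrt (nrm2 k (border_vec k w')))))%:E)).
    apply: leeD2r; rewrite lee_fin /=; case: asboolP => [lt|_]; last by rewrite expR_ge0.
    rewrite -expR0 ler_expR mulr_ge0 ?ltW// subr_gt0//.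
  rewrite /H -EFinM -!EFinD lee_fin.
  set r := Num.sqrt _.
  have rE : (nrm2 k (border_vec k w') = r ^+ 2)%R by rewrite sqr_sqrtr// nrm2_ge0.
  have hr := expR_chi r.
  rewrite rE.
  have -> : (th * (`|mat w' k k| + r + c - t) = th * (c - t) + th * `|mat w' k k| + th * r)%R by ring.
  rewrite !expRD /K1.
  have h1 := ler_wpM2l (mulr_ge0 (expR_ge0 (th * (c - t))) (expR_ge0 (th * `|mat w' k k|))) hr.
  have h2 := ler_wpM2l DC0 hr.
  lra.
apply: (@le_trans _ _ (gauss_coords (square_idx k.+1) (fun w => ib1 w + ib2 w) w)).
  apply: gauss_coords_le.
  - exact: mvar_pindic_mat.
  - by move=> d' S h mh; apply: emeasurable_funD; [exact: mib1|exact: mib2].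
  - by move=> v; exact: pindic_ge0.
  - by move=> v; apply: pindic_or => /(bad_lastE x0); rewrite -cE => /bade_split.
rewrite /= gauss_coords_cat.
apply: (@le_trans _ _ (gauss_coord (inr (k, k)) (gauss_coords (border_idx k k) H) w)).
  have m12 : mvar (fun w => ib1 w + ib2 w).
    by move=> d' S h mh; apply: emeasurable_funD; [exact: mib1|exact: mib2].
  have i120 v : 0 <= ib1 v + ib2 v by rewrite adde_ge0 ?pindic_ge0.
  apply: gauss_coord_le.
  - by apply: mvar_gauss_coords; [exact: mvar_gauss_coords|exact: gauss_coords_ge0].
  - exact: mvar_gauss_coords.
  - by apply: gauss_coords_ge0; exact: gauss_coords_ge0.
  - by apply: gauss_coords_le => //; [exact: mvar_gauss_coords|exact: gauss_coords_ge0].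
have -> : gauss_coords (border_idx k k) H = fun w => (K1 k c w * kap ^+ k + goeD * goeC * (goeC * k%:R))%:E.
  have mc : mvar (fun _ : J -> R => (goeD * goeC * (goeC * k%:R))%:E).
    by move=> d' S h mh; exact: measurable_cst.
  have KE0 v : 0 <= (K1 k c v)%:E * (expR (al * nrm2 k (border_vec k v)))%:E.
    by rewrite mule_ge0// lee_fin.
  rewrite /H (gauss_coordsD _ mKE mc KE0 (fun=> cst0)).
  rewrite gauss_coordsZl//; last first.
    move=> [i|[a b]] v z; first by rewrite mem_border_idx_inl.
    rewrite mem_border_idx_inr => ab; rewrite /K1 /mat /upd.
    rewrite (_ : (inr (k, k) == inr (a, b) :> J) = (k == a) && (k == b))//.
    suff -> : (k == a) && (k == b) = false by [].
    by apply/negbTE/negP => /andP[/eqP E1 /eqP E2]; move: ab; rewrite -E1 -E2 ltnn !andbF.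
  apply/funext => v; rewrite gauss_coords_border_expR// gauss_coords_id//.
rewrite /gauss_coord /K1 /mat.
under [X in gauss_int X]eq_fun => z.
  rewrite /upd eqxx normrM (ger0_norm (sqrtr_ge0 _)) (mulrA th).
  rewrite (_ : (_ + _)%:E = (expR (th * (c - t)) * B0 * kap ^+ k)%:E * (expR (th * Num.sqrt 2 * `|z|))%:E
      + (goeD * goeC * B0 * kap ^+ k + goeD * goeC * (goeC * k%:R))%:E); last first.
    by rewrite -EFinM -EFinD; congr EFin; ring.
  over.
have kk0 : (0 <= kap ^+ k)%R by rewrite exprn_ge0// (le_trans ler01).
have me : measurable_fun setT (fun z : measurableTypeR R => (expR (th * Num.sqrt 2 * `|z|))%:E).
  by apply/measurable_EFinP; apply: measurableT_comp => //; apply: measurable_funM.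
rewrite gauss_intD//; last 3 first.
- by apply: emeasurable_funM.
- by move=> z; rewrite mule_ge0 ?lee_fin ?mulr_ge0 ?expR_ge0.
- by move=> z; rewrite lee_fin addr_ge0// !mulr_ge0 ?expR_ge0.
rewrite gauss_int_cst; last by rewrite lee_fin addr_ge0// !mulr_ge0 ?expR_ge0.
rewrite gauss_intZl//; last by rewrite lee_fin !mulr_ge0 ?expR_ge0.
have ths : (0 <= th * Num.sqrt 2)%R by rewrite mulr_ge0 ?ltW.
have A0 : (0 <= expR (th * (c - t)) * B0 * kap ^+ k)%R by rewrite !mulr_ge0 ?expR_ge0.
apply: le_trans (leeD2r _ (lee_wpmul2l _ (gauss_int_expR_norm ths))) _; first by rewrite lee_fin.
rewrite -EFinM -EFinD lee_fin exprMn sqr_sqrtr//.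
have hk := chi_const (ltnW kd).
have -> : (th ^+ 2 * 2 / 2 = th ^+ 2)%R by field.
have h1 := ler_wpM2l DC0 hk.
have h2 := ler_wpM2l (mulr_ge0 (mulr_ge0 (ler0n R 2) (expR_ge0 (th ^+ 2 - th * t)))
   (expR_ge0 (th * c))) hk.
have e1 : (expR (th * (c - t)) * expR (th ^+ 2) = expR (th ^+ 2 - th * t) * expR (th * c))%R.
  by rewrite -!expRD; congr expR; ring.
rewrite -natr1.
have -> : (expR (th * (c - t)) * B0 * kap ^+ k * (2 * expR (th ^+ 2)) =
   2%:R * expR (th ^+ 2 - th * t) * expR (th * c) * (B0 * kap ^+ k))%R.
  transitivity (2%:R * (expR (th * (c - t)) * expR (th ^+ 2)) * (B0 * kap ^+ k))%R; first by ring.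
  by rewrite e1; ring.
rewrite /goeD in h1 h2 *.
lra.
Qed.

(** The term linear in [k] is the union bound over removed rows; the dependence on [x] is kept as an
    exponential so that the next step can average it. *)
Lemma pbad_bound k x w : (k <= d)%N ->
  pbad k t x w <= (goeD * goeC * (goeC * k%:R + expR (th * Num.sqrt (nrm2 k x))))%:E.
Proof.
elim: k x w => [|k IH] x w kd.
  by rewrite pbad0 lee_fin !(mulr_ge0, addr_ge0) ?expR_ge0.
have [x' [x'0 x'n x'b]] := pbad_last k t x.
rewrite (le_trans (x'b w))// -x'n; apply: pbad_step => //.
by move=> y v; apply: IH; exact: ltnW.
Qed.

End goe_bound.

(** * From the orthogonal ensemble to the Wigner matrix *)

Section wigner.
Context {R : realType}.
Local Notation J := (nat + nat * nat)%type.
Implicit Types (w : J -> R).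

(** The [inl] coordinates hold the eigenvalue noise [Y], reused here as the extra diagonal noise. *)
Definition wigner_idx k : seq J := [seq inl i | i <- iota 0 k] ++ square_idx k.

Lemma mem_wigner_idx_inl k i : (inl i \in wigner_idx k) = (i < k)%N.
Proof.
rewrite mem_cat mem_square_idx_inl orbF mem_map; last by move=> a b [].
by rewrite mem_iota add0n.
Qed.

Lemma mem_wigner_idx_inr k a b : (inr (a, b) \in wigner_idx k) = ((a < k) && (b < k))%N.
Proof.
rewrite mem_cat mem_square_idx_inr (_ : _ \in map _ _ = false)//.
by apply/negbTE/mapP => -[].
Qed.

Lemma uniq_wigner_idx k : uniq (wigner_idx k).
Proof.
rewrite cat_uniq uniq_square_idx map_inj_uniq ?iota_uniq /=; last by move=> a b [].
rewrite andbT; apply/hasPn => -[i|p]; first by rewrite mem_square_idx_inl.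
by move=> _; apply/mapP => -[].
Qed.

Definition upper w (i j : nat) : R := if (i <= j)%N then w (inr (i, j)) else w (inr (j, i)).
(* For [sg = 1] and [sg = -1] the diagonal has variance 2, as in [matG]; the case
   [sg = 0] is the average of the two. *)
Definition matW (sg : R) w (i j : nat) : R := upper w i j + sg * ((i == j)%:R * w (inl i)).
Definition matG w (i j : nat) : R := if i == j then Num.sqrt 2 * w (inr (i, i)) else upper w i j.

Let x0 : nat -> R := fun=> 0.

Lemma eq_qf_sym k (A A' : nat -> nat -> R) v :
  (forall i j, (i < k)%N -> (j < k)%N -> A i j + A j i = A' i j + A' j i) ->
  qf k A v = qf k A' v.
Proof.
move=> AA.
have sym (B : nat -> nat -> R) :
    qf k B v = (\sum_(i < k) \sum_(j < k) v i * (B i j + B j i) * v j) / 2.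
  have E : qf k B v = \sum_(i < k) \sum_(j < k) v i * B j i * v j.
    by rewrite /qf exchange_big; apply: eq_bigr => i _; apply: eq_bigr => j _; ring.
  rewrite -[LHS](mulfK (_ : 2 != 0 :> R)) ?pnatr_eq0//; congr (_ / _).
  rewrite mulr_natr mulr2n {2}E /qf -big_split /=; apply: eq_bigr => i _.
  by rewrite -big_split /=; apply: eq_bigr => j _; ring.
rewrite !sym; congr (_ / _); apply: eq_bigr => i _; apply: eq_bigr => j _.
by rewrite AA.
Qed.

Lemma eq_bad_sym k t x (A A' : nat -> nat -> R) :
  (forall i j, (i < k)%N -> (j < k)%N -> A i j + A j i = A' i j + A' j i) ->
  bad k t x A <-> bad k t x A'.
Proof.
move=> AA; split=> -[v v0]; exists v; move: v0; rewrite /excess.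
  by rewrite (eq_qf_sym v AA).
by rewrite (eq_qf_sym v AA).
Qed.

Lemma upperC w i j : upper w i j = upper w j i.
Proof. by rewrite /upper; case: ltngtP => // ->. Qed.

Lemma mvar_upper i j : mvar (fun w => upper w i j).
Proof. by move=> d S h mh; rewrite /upper; case: (i <= j)%N. Qed.

Lemma mvar_matW sg i j : mvar (fun w => matW sg w i j).
Proof.
apply: mvarD; first exact: mvar_upper.
by apply: mvarM; [exact: mvar_cst|apply: mvarM; [exact: mvar_cst|exact: mvar_proj]].
Qed.

Lemma mvar_matG i j : mvar (fun w => matG w i j).
Proof.
rewrite /matG; case: eqP => _; last exact: mvar_upper.
by apply: mvarM; [exact: mvar_cst|exact: mvar_proj].
Qed.

Lemma mvar_pindic_bad k t (A : (J -> R) -> nat -> nat -> R) :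
  (forall i j, mvar (fun w => A w i j)) -> mvar (fun w => pindic (bad k t x0 (A w)) : \bar R).
Proof.
move=> mA; apply: (@mvar_bad _ _ k t (fun=> x0) A) => // i.
exact: mvar_cst.
Qed.

Let s2 : R := Num.sqrt 2 / 2.

Let s2E : s2 ^+ 2 + s2 ^+ 2 = 1.
Proof. by rewrite /s2 expr_div_n sqr_sqrtr//; field. Qed.

Let s20 : s2 != 0.
Proof. by rewrite mulf_neq0// ?invr_eq0 ?pnatr_eq0// gt_eqF// sqrtr_gt0. Qed.

Let s22 : Num.sqrt 2 * s2 = 1.
Proof. by rewrite /s2 mulrA -expr2 sqr_sqrtr// divff. Qed.

Local Open Scope ereal_scope.

(** A rotation by 45 degrees of each pair of mirror entries turns [sqrt 2 * (M i j + M j i) / 2]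
    into a single standard normal entry; the diagonals already agree. *)
Lemma gauss_coords_matG k t : gauss_coords (wigner_idx k) (fun w => pindic (bad k t x0 (matG w)) : \bar R) =
  gauss_coords (wigner_idx k) (fun w => pindic (bad k t x0 (mat w))).
Proof.
pose src := [seq p <- [seq (i, j) | i <- iota 0 k, j <- iota 0 k] | (p.1 < p.2)%N].
pose ps : seq (J * J) := [seq (inr p, inr (p.2, p.1)) | p <- src].
have srcE i j : ((i, j) \in src) = [&& (i < j)%N, (i < k)%N & (j < k)%N].
  rewrite mem_filter /=; congr (_ && _).
  apply/allpairsP/andP => [[[a b] /= [+ + [-> ->]]]|[ik jk]].
    by rewrite !mem_iota !add0n /= => -> ->.
  by exists (i, j); rewrite /= !mem_iota !add0n ik jk.
have ups : uniq (unzip1 ps ++ unzip2 ps).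
  have us : uniq src.
    by apply: filter_uniq; apply: allpairs_uniq; [exact: iota_uniq|exact: iota_uniq|move=> [a b] [a' b']].
  rewrite cat_uniq /unzip1 /unzip2 -!map_comp !map_inj_uniq ?us//= ?andbT; last 2 first.
  - by move=> [a b] [a' b'] /= [-> ->].
  - by move=> a b /= [->].
  apply/hasPn => _ /mapP[[a b] ab ->]; apply/mapP => -[[a' b'] ab' /= [E1 E2]].
  move: ab ab'; rewrite !srcE -E1 -E2 => /andP[ab _] /andP[ba _].
  by have := ltn_trans ab ba; rewrite ltnn.
have Hps : forall p, p \in ps -> [/\ p.1 != p.2, p.1 \in wigner_idx k & p.2 \in wigner_idx k].
  move=> p /mapP[[a b]]; rewrite srcE => /and3P[ab ak bk] -> /=.
  rewrite !mem_wigner_idx_inr ak bk; split=> //; apply/eqP => -[E _].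
  by rewrite E ltnn in ab.
rewrite -(@gauss_coords_acts _ _ _ _ ps _ _ s2E s20 (uniq_wigner_idx k) Hps (mvar_pindic_bad k t mvar_mat)); last first.
  by move=> w; exact: pindic_ge0.
congr gauss_coords; apply/funext => w; rewrite /pindic; congr ((nat_of_bool _)%:R)%:E.
apply/asbool_equiv_eq; apply: eq_bad_sym => i j.
wlog ij : i j / (i <= j)%N => [wl ik jk|ik jk].
  have [ij|ji] := leqP i j; first exact: wl.
  by rewrite addrC [RHS]addrC wl// ltnW.
move: ij; rewrite leq_eqVlt => /orP[/eqP <-|ij].
  rewrite /matG eqxx /mat acts_out//.
    by apply/mapP => -[_ /mapP[[a b] + ->]] /= [E1 E2]; rewrite srcE -E1 -E2 ltnn.
  by apply/mapP => -[_ /mapP[[a b] + ->]] /= [E1 E2]; rewrite srcE -E1 -E2 ltnn.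
have pin : (inr (i, j), inr (j, i)) \in ps.
  by apply/mapP; exists (i, j) => //; rewrite srcE ij ik jk.
have [Ep Eq] := acts_in s2 s2 w ups pin.
rewrite /matG (ltn_eqF ij) eq_sym (ltn_eqF ij) (upperC w j i) /upper (ltnW ij) /mat Ep Eq.
transitivity ((Num.sqrt 2 * s2) * w (inr (i, j)) *+ 2)%R; last by ring.
by rewrite s22 mul1r mulr2n.
Qed.

Lemma gauss_coords_matW k t (sg : R) : (sg ^+ 2 = 1)%R ->
  gauss_coords (wigner_idx k) (fun w => pindic (bad k t x0 (matW sg w)) : \bar R) =
  gauss_coords (wigner_idx k) (fun w => pindic (bad k t x0 (matG w))).
Proof.
move=> sg1; pose ps : seq (J * J) := [seq (inr (i, i), inl i) | i <- iota 0 k].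
have ups : uniq (unzip1 ps ++ unzip2 ps).
  rewrite cat_uniq /unzip1 /unzip2 -!map_comp !map_inj_uniq ?iota_uniq//= ?andbT; last 2 first.
  - by move=> a b [].
  - by move=> a b [].
  by apply/hasPn => _ /mapP[a _ ->]; apply/mapP => -[].
have Hps : forall p, p \in ps -> [/\ p.1 != p.2, p.1 \in wigner_idx k & p.2 \in wigner_idx k].
  move=> p /mapP[i]; rewrite mem_iota add0n => /andP[_ ik] -> /=.
  by rewrite mem_wigner_idx_inr mem_wigner_idx_inl ik.
(* This sine turns [sqrt 2] times the rotated diagonal entry into
   [w (inr (i, i)) + sg * w (inl i)]. *)
pose s : R := (- (sg * s2))%R.
have cs : (s2 ^+ 2 + s ^+ 2 = 1)%R by rewrite /s sqrrN [X in (_ + X)%R]exprMn sg1 mul1r.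
have s0 : s != 0%R.
  rewrite /s oppr_eq0 mulf_neq0//; apply/eqP => sg0; move: sg1.
  by rewrite sg0 expr0n => /esym/eqP; rewrite oner_eq0.
rewrite -(@gauss_coords_acts _ _ _ _ ps _ _ cs s0 (uniq_wigner_idx k) Hps (mvar_pindic_bad k t mvar_matG)); last first.
  by move=> w; exact: pindic_ge0.
congr gauss_coords; apply/funext => w; rewrite /pindic; congr ((nat_of_bool _)%:R)%:E.
apply/asbool_equiv_eq.
suff AA i j : (i < k)%N -> (j < k)%N ->
    matW sg w i j = matG (acts s2 s ps w) i j.
  by apply: eq_bad_sym => i j ik jk; rewrite !AA.
move=> ik jk; rewrite /matW /matG; have [<-|ij] := eqVneq i j.
  have pin : (inr (i, i), inl i) \in ps.
    by apply/mapP; exists i => //; rewrite mem_iota add0n.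
  have [-> _] := acts_in s2 s w ups pin.
  rewrite /upper leqnn /s.
  transitivity ((Num.sqrt 2 * s2) * (w (inr (i, i)) + sg * w (inl i)))%R; last by ring.
  by rewrite s22 /= mulr1n !mul1r.
rewrite mul0r mulr0 addr0 /upper.
have out a b : a != b -> acts s2 s ps w (inr (a, b)) = w (inr (a, b)).
  move=> ab; rewrite acts_out//; apply/mapP => -[_ /mapP[c _ ->]] //= [E1 E2].
  by rewrite E1 E2 eqxx in ab.
by rewrite !out// eq_sym.
Qed.

(** The form of an average is at most the larger of the two forms in absolute value, so the same
    witness works for one of the signs. *)
Lemma bad_matW k t w : bad k t x0 (matW 0%R w) ->
  bad k t x0 (matW 1%R w) \/ bad k t x0 (matW (-1)%R w).
Proof.
move=> [v v0].
have E : (qf k (matW 0 w) v = (qf k (matW 1 w) v + qf k (matW (-1) w) v) / 2)%R.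
  rewrite /qf -big_split /= mulr_suml; apply: eq_bigr => i _.
  rewrite -big_split /= mulr_suml; apply: eq_bigr => j _; by rewrite /matW; field.
have := v0; rewrite /excess E => v0'.
have [h|h] := leP `|qf k (matW 1 w) v|%R `|qf k (matW (-1) w) v|%R.
  right; exists v; rewrite /excess (lt_le_trans v0')// lerD2r lerD2r normrM.
  rewrite (ger0_norm (_ : 0 <= 2^-1)%R) ?invr_ge0//.
  rewrite ler_pdivrMr// (le_trans (ler_normD _ _))//; lra.
left; exists v; rewrite /excess (lt_le_trans v0')// lerD2r lerD2r normrM.
rewrite (ger0_norm (_ : 0 <= 2^-1)%R) ?invr_ge0//.
rewrite ler_pdivrMr// (le_trans (ler_normD _ _))//; lra.
Qed.

Lemma wigner_bound k t th w : (0 < k)%N -> (0 < th)%R ->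
  gauss_coords (wigner_idx k) (fun w => pindic (bad k t x0 (matW 0%R w))) w <=
  (2 * (goeD th t * goeC k th * (goeC k th * k%:R + 1)))%:E.
Proof.
move=> k0 th0.
have mW sg := mvar_pindic_bad k t (mvar_matW sg).
have i0 (A : (J -> R) -> nat -> nat -> R) (w' : J -> R) :
  0 <= (pindic (bad k t x0 (A w')) : \bar R) by exact: pindic_ge0.
apply: (@le_trans _ _ (gauss_coords (wigner_idx k) (fun w => pindic (bad k t x0 (matW 1%R w)) +
    pindic (bad k t x0 (matW (-1)%R w))) w)).
  apply: gauss_coords_le => // [|w'].
    by move=> d S h mh; apply: emeasurable_funD; exact: mW.
  by apply: pindic_or; exact: bad_matW.
rewrite gauss_coordsD//.
rewrite gauss_coords_matW ?expr1n// gauss_coords_matW ?sqrrN ?expr1n// gauss_coords_matG /wigner_idx gauss_coords_cat.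
have B w' : gauss_coords (square_idx k) (fun w => pindic (bad k t x0 (mat w))) w' <=
    (goeD th t * goeC k th * (goeC k th * k%:R + 1))%:E.
  have := @pbad_bound _ k th t k0 th0 k x0 w' (leqnn k).
  rewrite /pbad (_ : nrm2 k x0 = 0%R) ?sqrtr0 ?mulr0 ?expR0//.
  by rewrite /nrm2 big1// => i _; rewrite expr0n.
set K := (goeD _ _ * _ * _)%R in B *.
have K0 : (0 <= K)%R by have := le_trans (gauss_coords_ge0 (square_idx k) (i0 mat) w) (B w); rewrite lee_fin.
have BB : gauss_coords [seq inl i | i <- iota 0 k] (gauss_coords (square_idx k) (fun w => pindic (bad k t x0 (mat w)))) w <= K%:E.
  apply: (@le_trans _ _ (gauss_coords [seq inl i | i <- iota 0 k] (fun _ : J -> R => K%:E) w)).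
    apply: gauss_coords_le => //; last by move=> v; exact: gauss_coords_ge0.
    by apply: mvar_gauss_coords => //; exact: mvar_pindic_bad mvar_mat.
  by rewrite gauss_coords_id.
by rewrite mulr2n mulrDl !mul1r EFinD leeD.
Qed.

End wigner.

(** * From the finite family of noise variables to coordinates indexed by [nat] *)

Section transfer.
Context {R : realType} (d : nat).
Local Notation I := ('I_d + 'I_d * 'I_d)%type.
Local Notation J := (nat + nat * nat)%type.

Definition emb (i : I) : J :=
  match i with inl a => inl (val a) | inr p => inr (val p.1, val p.2) end.

Definition ext (u : I -> R) (j : J) : R :=
  match j with
  | inl n => if insub n is Some i then u (inl i) else 0
  | inr (a, b) => match insub a, insub b with
                  | Some i, Some j => u (inr (i, j))
                  | _, _ => 0
                  end
  end.

Lemma emb_inj : injective emb.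
Proof.
move=> [a|[a b]] [a'|[a' b']] //= [].
  by move=> /val_inj ->.
by move=> /val_inj -> /val_inj ->.
Qed.

Lemma ext_emb u i : ext u (emb i) = u i.
Proof. by case: i => [a|[a b]] /=; rewrite !valK. Qed.

Lemma ext_upd u i z : ext (upd u i z) = upd (ext u) (emb i) z.
Proof.
apply/funext => j; rewrite [RHS]/upd.
have [->|ji] := eqVneq j (emb i); first by rewrite ext_emb /upd eqxx.
case: j ji => [n|[a b]] /=.
  case: insubP => // k _ <- ji; rewrite /upd; case: eqP => // E.
  by rewrite -E /= eqxx in ji.
case: insubP => // k _ <-; case: insubP => // l _ <- ji; rewrite /upd; case: eqP => // E.
by rewrite -E /= eqxx in ji.
Qed.

Lemma gauss_coords_ext (s : seq I) (F : (J -> R) -> \bar R) u :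
  gauss_coords s (fun u => F (ext u)) u = gauss_coords (map emb s) F (ext u).
Proof.
elim: s u => //= i s IH u; rewrite /gauss_coord; congr gauss_int; apply/funext => z.
by rewrite IH ext_upd.
Qed.

Lemma perm_emb : perm_eq (map emb (enum {: I})) (wigner_idx d).
Proof.
apply: uniq_perm; [by rewrite map_inj_uniq ?enum_uniq//; exact: emb_inj|exact: uniq_wigner_idx|].
move=> [n|[a b]].
  rewrite mem_wigner_idx_inl; apply/mapP/idP => [[[i|[i j]] _ //= [->]]|nd]; first exact: ltn_ord.
  by exists (inl (Ordinal nd)); rewrite ?mem_enum.
rewrite mem_wigner_idx_inr; apply/mapP/andP => [[[i|[i j]] _ //= [-> ->]]|[ad bd]].
  by rewrite !ltn_ord.
by exists (inr (Ordinal ad, Ordinal bd)); rewrite ?mem_enum.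
Qed.

Lemma mvar_ext j : mvar (fun u : I -> R => ext u j).
Proof.
move=> d' S h mh; case: j => [n|[a b]] /=.
  by case: insubP => // *; exact: measurable_cst.
by case: insubP => [? _ _|_]; [case: insubP => // *|]; exact: measurable_cst.
Qed.

End transfer.

(** * Numerical estimates for the two tails *)

Section numeric.
Import numFieldNormedType.Exports.
Context {R : realType}.

Lemma expR_sinh_ge (x : R) : 0 <= x -> 2 * x <= expR x - expR (- x).
Proof.
move=> x0.
pose f (z : R) : R := expR z - expR (- z) - 2 * z.
have df (z : R) : is_derive z 1 f (expR z + expR (- z) - 2).
  have dN : is_derive z 1 (fun y : R => expR (- y)) (- expR (- z)).
    apply: (is_derive_eq (is_derive1_comp (f := expR) (g := -%R) _ _)).
    by rewrite ?mulrN1 ?mulN1r.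
  apply: (is_derive_eq (is_deriveB (is_deriveB (is_derive_expR z) dN) (is_deriveZ 2 (is_derive_id z 1)))).
  by rewrite opprK scaler1.
have f0 : f 0 = 0 by rewrite /f oppr0 subrr mulr0 subr0.
suff : f 0 <= f x by rewrite f0 /f; lra.
have dd z : z \in `]0, +oo[ -> derivable f z 1 by move=> _; case: (df z).
have ge z : z \in `]0, +oo[ -> 0 <= derive1 f z.
  move=> _; rewrite derive1E derive_val.
  have e0 := expR_gt0 z; have ee : expR z * expR (- z) = 1 by rewrite -expRD subrr expR0.
  have h := sqr_ge0 (expR z - 1).
  rewrite -(@pmulr_rge0 _ (expR z))// mulrBr mulrDr ee; nra.
apply: (ger0_derive1_ndecry dd ge) => //.
by apply: derivable_within_continuous => z _; case: (df z).
Qed.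

Lemma logc_ge1 (x : R) : 1 <= logc x.
Proof.
rewrite /logc; case: ifPn => //; rewrite -ltNge => /ltW ex.
by rewrite -ler_expR lnK// posrE (lt_le_trans (expR_gt0 1)).
Qed.

Lemma logc_ge (x : R) : 0 < x -> x <= expR (logc x).
Proof.
by move=> x0; rewrite /logc; case: ifPn => // _; rewrite lnK.
Qed.

Lemma expRN_logc (b : R) : 0 < b -> expR (- logc b^-1) <= b.
Proof.
move=> b0; have := logc_ge (_ : 0 < b^-1); rewrite invr_gt0 => /(_ b0) h.
by rewrite expRN -[leRHS]invrK lef_pV2 ?posrE ?expR_gt0 ?invr_gt0.
Qed.

(** For this [a], [1 - 2 a = sqrt d / (sqrt d + 2 sqrt tau)], and the claim reduces to [x <= sinh x]
    with [x = - ln (1 - 2 a)]. *)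
Lemma chi2_exponent (d : nat) (tau : R) : (0 < d)%N -> 0 < tau ->
  let a := Num.sqrt tau / (Num.sqrt d%:R + 2 * Num.sqrt tau) in
  [/\ a < 1 / 2, 0 < a &
  expR (- (a * (d%:R + 2 * Num.sqrt (d%:R * tau) + 2 * tau))) * (Num.sqrt (1 - 2 * a))^-1 ^+ d
    <= expR (- tau)].
Proof.
move=> d0 tau0; set D := Num.sqrt d%:R; set r := Num.sqrt tau => a.
have D0 : 0 < D by rewrite sqrtr_gt0 ltr0n.
have r0 : 0 < r by rewrite sqrtr_gt0.
have dE : d%:R = D ^+ 2 by rewrite sqr_sqrtr// ler0n.
have tE : tau = r ^+ 2 by rewrite sqr_sqrtr// ltW.
have Dr0 : 0 < D + 2 * r by rewrite addr_gt0// mulr_gt0.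
have aE : 1 - 2 * a = D / (D + 2 * r) by rewrite /a; field; rewrite gt_eqF.
split; [by rewrite /a ltr_pdivrMr//; lra|by rewrite divr_gt0|].
set kap := (_^-1 : R).
have kap2 : kap ^+ 2 = (D + 2 * r) / D.
  by rewrite exprVn sqr_sqrtr aE ?invf_div// divr_ge0// ltW.
have kap0 : 0 < kap by rewrite invr_gt0 sqrtr_gt0 aE divr_gt0.
have kap1 : 1 <= kap.
  rewrite -(@ler_pXn2r _ 2)//; [|by rewrite nnegrE|by rewrite nnegrE ltW].
  by rewrite kap2 expr1n ler_pdivlMr// mul1r lerDl mulr_ge0// ltW.
have ln0 : 0 <= ln kap by rewrite -ler_expR lnK ?posrE// expR0.
have kE : kap = expR (ln kap) by rewrite lnK.
have k2E : kap ^+ 2 = expR (2 * ln kap) by rewrite {1}kE -expRM_natl.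
have := expR_sinh_ge (mulr_ge0 (ler0n R 2) ln0).
rewrite expRN -k2E kap2 invf_div => h.
rewrite {1}kE -expRM_natl -expRD ler_expR sqrtrM ?ler0n// -/D -/r dE tE.
have h' := ler_wpM2l (_ : 0 <= D ^+ 2 / 4) h.
have {}h' := h' (divr_ge0 (sqr_ge0 D) (ler0n _ 4)).
rewrite -subr_ge0; rewrite -subr_ge0 in h'.
suff -> : - r ^+ 2 - (- (a * (D ^+ 2 + 2 * (D * r) + 2 * r ^+ 2)) + D ^+ 2 * ln kap) =
  D ^+ 2 / 4 * ((D + 2 * r) / D - D / (D + 2 * r)) - D ^+ 2 / 4 * (2 * (2 * ln kap)) by [].
by rewrite /a; field; rewrite !gt_eqF.
Qed.

(** Since [ln (1 + eps) <= eps <= (1 + eps) ^+ 2], the quotient in the third term is at least 1; the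
    second term is dropped. *)
Lemma upsilon_ge (d : nat) (beta : R) : (0 < d)%N ->
  2 * Num.sqrt d%:R + 6 * Num.sqrt (logc d%:R) + 2 * Num.sqrt (2 * logc beta^-1)
    <= upsilon_fn d beta.
Proof.
move=> d0; rewrite /upsilon_fn; set l := logc d%:R; set eps := (l / d%:R) `^ _; set L := logc _.
have l1 : 1 <= l := logc_ge1 _.
have dR0 : (0 : R) < d%:R by rewrite ltr0n.
have eps0 : 0 < eps by rewrite powR_gt0// divr_gt0// (lt_le_trans ltr01).
have le0 : 0 < ln (1 + eps) by rewrite ln_gt0// ltrDl.
have lee : ln (1 + eps) <= (1 + eps) ^+ 2.
  have := @le_ln1Dx R eps; rewrite (lt_trans _ eps0) ?ltrN10// => /(_ isT) h.
  rewrite (le_trans h)// sqrrD expr1n; nra.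
have sle : Num.sqrt (ln (1 + eps)) <= 1 + eps.
  have e10 : 0 <= 1 + eps by rewrite addr_ge0// ltW.
  by rewrite -(@ler_pXn2r _ 2)// ?nnegrE// sqr_sqrtr// ltW.
have third : 6 * Num.sqrt l <= 6 * (1 + eps) * Num.sqrt l / Num.sqrt (ln (1 + eps)).
  rewrite ler_pdivlMr ?sqrtr_gt0// mulrAC -!mulrA ler_wpM2l//.
  by rewrite mulrC (mulrC (1 + eps)) ler_wpM2l ?sqrtr_ge0.
rewrite lerD2r -[leRHS]addrA lerD2l; apply: (le_trans third); rewrite lerDr.
by rewrite !mulr_ge0 ?powR_ge0.
Qed.

Lemma upsilon_ge0 (d : nat) (beta : R) : 0 <= upsilon_fn d beta.
Proof.
rewrite /upsilon_fn !addr_ge0 ?mulr_ge0 ?powR_ge0 ?sqrtr_ge0 ?invr_ge0 ?sqrtr_ge0//.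
by rewrite addr_ge0 ?powR_ge0.
Qed.

(** With [s = t - 2 sqrt d], the total exponent is [2 th ^+ 2 - th * s], minimized at [th = s / 4]
    with value [- s ^+ 2 / 8]. *)
Lemma wigner_numeric (d : nat) (beta : R) : (0 < d)%N -> 0 < beta ->
  let t := upsilon_fn d beta in let th := (t - 2 * Num.sqrt d%:R) / 4 in
  0 < th /\ 2 * (goeD th t * goeC d th * (goeC d th * d%:R + 1)) <= beta.
Proof.
move=> d0 b0 t th; set sd := (Num.sqrt d%:R : R); set l := logc (d%:R : R); set L := logc beta^-1.
have ut : 2 * sd + 6 * Num.sqrt l + 2 * Num.sqrt (2 * L) <= t := upsilon_ge beta d0.
have l1 : 1 <= l := logc_ge1 _. have L1 : 1 <= L := logc_ge1 _.
pose s := t - 2 * sd.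
have sl1 : 1 <= Num.sqrt l by rewrite -[leLHS]sqrtr1 ler_wsqrtr.
have sL0 : 0 <= Num.sqrt (2 * L) by [].
have sge : 6 * Num.sqrt l + 2 * Num.sqrt (2 * L) <= s by rewrite /s; lra.
have th0 : 0 < th by rewrite /th -/s divr_gt0//; lra.
split=> //.
have C1 : 1 <= goeC d th.
  rewrite /goeC -expR0 ler_expR; apply: addr_ge0; last by rewrite divr_ge0// sqr_ge0.
  by apply: mulr_ge0; rewrite ?sqrtr_ge0// ltW.
have D0 : 0 <= goeD th t by rewrite mulr_ge0 ?expR_ge0.
have C0 : 0 <= goeC d th by exact: le_trans C1.
apply: (@le_trans _ _ (2 * (goeD th t * goeC d th * (goeC d th * d.+1%:R)))).
  rewrite ler_wpM2l// ler_wpM2l ?mulr_ge0// -natr1 mulrDr mulr1 lerD2l//.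
have -> : 2 * (goeD th t * goeC d th * (goeC d th * d.+1%:R)) = 4 * d.+1%:R * expR (- (s ^+ 2 / 8)).
  transitivity (4 * d.+1%:R * (expR (th ^+ 2 - th * t) * goeC d th * goeC d th)).
    by rewrite /goeD; ring.
  congr (_ * _); rewrite /goeC -!expRD; congr expR; rewrite /th -/s -/sd.
  have -> : t = s + 2 * sd by rewrite /s; ring.
  by field.
have s2 : 36 * l + 8 * L <= s ^+ 2.
  have lE : Num.sqrt l ^+ 2 = l by rewrite sqr_sqrtr//; lra.
  have LE : Num.sqrt (2 * L) ^+ 2 = 2 * L by rewrite sqr_sqrtr//; lra.
  have : (6 * Num.sqrt l + 2 * Num.sqrt (2 * L)) ^+ 2 <= s ^+ 2.
    by rewrite ler_pXn2r// nnegrE; lra.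
  have : 0 <= Num.sqrt l * Num.sqrt (2 * L) by rewrite mulr_ge0.
  rewrite sqrrD !exprMn lE LE; lra.
(* Of the four factors [exp (- l)], one reduces [d.+1] to at most 2; the other three are at most 1/2
   each and absorb the remaining constant 8. The convention [logc >= 1] keeps this valid for small
   [d]. *)
have e1 : expR (- (s ^+ 2 / 8)) <= expR (- L) * (expR (- l) * expR (- l) * expR (- l) * expR (- l)).
  by rewrite -!expRD ler_expR; lra.
have dle : d%:R <= expR l by rewrite logc_ge// ltr0n.
have el2 : 2 <= expR l by rewrite (le_trans _ (expR_ge1Dx l))//; lra.
have ee : expR l * expR (- l) = 1 by rewrite -expRD subrr expR0.
have em0 := expR_gt0 (- l).
have em2 : expR (- l) <= 1 / 2.
  by rewrite expRN ler_pdivlMr// mulrC ler_pdivrMr ?expR_gt0// mul1r.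
have bL := expRN_logc b0; rewrite -/L in bL.
apply: (@le_trans _ _ (expR (- L))) => //.
have dd : d.+1%:R * expR (- l) <= 2.
  rewrite -natr1 mulrDl mul1r.
  have := ler_wpM2r (ltW em0) dle; rewrite ee; lra.
apply: le_trans (ler_wpM2l _ e1) _; first by rewrite mulr_ge0.
set e := expR (- l) in dd em0 em2 *.
have -> : 4 * d.+1%:R * (expR (- L) * (e * e * e * e)) = expR (- L) * (4 * (d.+1%:R * e) * (e * e * e)) by ring.
rewrite -[leRHS]mulr1 ler_wpM2l ?expR_ge0//.
have e3 : e * e * e <= 1 / 8.
  have h1 : e * e <= 1 / 4 by nra.
  by nra.
have e30 : 0 <= e * e * e by rewrite !mulr_ge0// ltW.
have de0 : 0 <= d.+1%:R * e by rewrite mulr_ge0// ltW.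
by nra.
Qed.

End numeric.

(** * The two bad events and the final bound *)

Section final.
Context {R : realType}.
Local Notation mR := (measurableTypeR R).

Lemma chi2_bound (d : nat) (tau : R) (u : 'I_d + 'I_d * 'I_d -> R) :
  (0 < d)%N -> 0 < tau ->
  (gauss_coords (enum {: 'I_d + 'I_d * 'I_d}) (fun u : 'I_d + 'I_d * 'I_d -> R =>
    pindic (d%:R + 2 * Num.sqrt (d%:R * tau) + 2 * tau < \sum_i u (inl i) ^+ 2)%R) u
   <= (expR (- tau))%:E)%E.
Proof.
move=> d0 tau0; have [a12 a0 hexp] := chi2_exponent d0 tau0.
set a := Num.sqrt tau / _ in a12 a0 hexp; set u0 := d%:R + _ + _ in hexp *.
(* The Chernoff weight acts on the [Y] coordinates and is 1 on the entries of [W], so its integral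
   factorizes. *)
pose f (i : 'I_d + 'I_d * 'I_d) (x : mR) : \bar R :=
  if i is inl _ then (expR (a * x ^+ 2))%:E else 1%E.
have mf i : measurable_fun setT (f i).
  case: i => [i|p] /=; last exact: measurable_cst.
  apply/measurable_EFinP; apply: measurableT_comp => //.
  by apply: measurable_funM => //; apply: measurable_funX.
have f0 i x : (0 <= f i x)%E by case: i => [i|p] /=; rewrite lee_fin ?expR_ge0.
have prodE (v : 'I_d + 'I_d * 'I_d -> R) :
    (\prod_(i <- enum {: 'I_d + 'I_d * 'I_d}) f i (v i) = (expR (a * \sum_i v (inl i) ^+ 2))%:E)%E.
  rewrite big_enum /= big_sumType /= [X in (_ * X)%E]big1// mule1 prodEFin.
  by rewrite mulr_sumr expR_sum.
have msum : mvar (fun v : 'I_d + 'I_d * 'I_d -> R => \sum_i v (inl i) ^+ 2).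
  by move=> d' S h mh; apply: measurable_sum => i; apply: measurable_funX.
have mE : mvar (fun v : 'I_d + 'I_d * 'I_d -> R => (expR (a * \sum_i v (inl i) ^+ 2))%:E).
  by apply: mvar_expR; apply: mvarM => //; exact: mvar_cst.
apply: (@le_trans _ _ (gauss_coords (enum {: 'I_d + 'I_d * 'I_d}) (fun v =>
  (expR (- (a * u0)))%:E * (expR (a * \sum_i v (inl i) ^+ 2))%:E)%E u)).
  apply: gauss_coords_le.
  - exact: mvar_gt.
  - by move=> d' S h mh; apply: emeasurable_funM => //; exact: mE.
  - by move=> v; exact: pindic_ge0.
  - move=> v; rewrite -EFinM lee_fin -expRD; case: asboolP => [lt|_] /=; last exact: expR_ge0.
    rewrite -expR0 ler_expR addrC -mulrBr; apply: mulr_ge0; first exact: ltW.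
    by rewrite subr_ge0 ltW.
rewrite gauss_coordsZl//.
rewrite (_ : (fun v : _ -> R => (expR (a * \sum_i v (inl i) ^+ 2))%:E) =
  fun v => (\prod_(i <- enum {: 'I_d + 'I_d * 'I_d}) f i (v i))%E); last first.
  by apply/funext => v; rewrite prodE.
rewrite gauss_coords_prod ?enum_uniq// big_enum /= big_sumType /=.
rewrite [X in (_ * (_ * X))%E]big1 ?mule1; last by move=> p _; rewrite gauss_int_cst.
rewrite (eq_bigr (fun=> ((Num.sqrt (1 - 2 * a))^-1)%:E)); last first.
  by move=> i _; rewrite gauss_int_expR_sqr.
by rewrite prodEFin prodr_const card_ord -EFinM lee_fin.
Qed.

Lemma indic_pindic (T : Type) (A : set T) x : ((\1_A x : R)%:E = pindic (A x))%E.
Proof. by rewrite indicE. Qed.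

Section events.
Context (dT : measure_display) (T : measurableType dT) (P : probability T R) (d : nat).
Local Notation I := ('I_d + 'I_d * 'I_d)%type.
Variable g : I -> T -> R.
Hypothesis mg : forall i, measurable_fun setT (g i).
Hypothesis gN : forall i B, measurable B -> P (g i @^-1` B) = normal_prob 0 1 B.
Hypothesis gI : mutually_independent P g.
Hypothesis d0 : (0 < d)%N.

(** The operator norm of [W] exceeds [t]: [matW 0] is [W] without the extra noise. *)
Definition opbad (t : R) : set T :=
  [set s | bad d t (fun=> 0) (matW 0 (ext (fun i => g i s)))].

Definition chibad (u0 : R) : set T := [set s | u0 < \sum_i g (inl i) s ^+ 2].

Lemma measurable_opbad t : measurable (opbad t).
Proof.
apply: (@measurable_bad _ _ _ d t (fun _ _ => 0)
  (fun i j s => matW 0 (ext (fun i => g i s)) i j)) => [i|i j]; first exact: measurable_cst.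
have h : mvar (fun u : I -> R => matW 0 (ext u) i j).
  move=> d' S h mh; apply: (mvar_matW _ _ _ (h := fun k s => ext (fun i => h i s) k)).
  by move=> k; exact: mvar_ext.
exact: h.
Qed.

Lemma measurable_chibad u0 : measurable (chibad u0).
Proof.
have mf : measurable_fun setT (fun s => \sum_i g (inl i) s ^+ 2).
  by apply: measurable_sum => i; apply: measurable_funX.
rewrite (_ : chibad u0 = (fun s => \sum_i g (inl i) s ^+ 2) @^-1` `]u0, +oo[%classic).
  by rewrite -[X in measurable X]setTI; exact: mf.
by apply/seteqP; split => s /=; rewrite in_itv/= andbT.
Qed.

Lemma prob_opbad beta : 0 < beta -> (P (opbad (upsilon_fn d beta)) <= beta%:E)%E.
Proof.
move=> b0; set t := upsilon_fn d beta.
have [th0 hb] := wigner_numeric d0 b0.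
set th := (_ / 4) in th0 hb.
pose A : set (I -> R) := [set u | bad d t (fun=> 0) (matW 0 (ext u))].
have mA : mvar (fun u : I -> R => (\1_A u : R)%:E).
  rewrite (_ : (fun u : I -> R => _) = fun u => pindic (A u)); last first.
    by apply/funext => u; rewrite indic_pindic.
  apply: (@mvar_bad _ _ d t (fun _ _ => 0) (fun u => matW 0 (ext u))) => [i|i j].
    exact: mvar_cst.
  move=> d' S h mh; apply: (mvar_matW _ _ _ (h := fun k s => ext (fun i => h i s) k)).
  by move=> k; exact: mvar_ext.
rewrite -[opbad t]/[set s | A (fun i => g i s)] (gauss_law (fun=> 0) mg gN gI mA).
rewrite (_ : (fun u : I -> R => _) =
   fun u => pindic (bad d t (fun=> 0) (matW 0 (ext u)))); last first.
  by apply/funext => u; rewrite indic_pindic.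
rewrite (@gauss_coords_ext _ _ _ (fun w => pindic (bad d t (fun=> 0) (matW 0 w)))).
rewrite (gauss_coords_perm _ _ (perm_emb d)).
- by apply: (le_trans (wigner_bound _ _ d0 th0)); rewrite lee_fin.
- exact: (mvar_pindic_bad d t (mvar_matW 0)).
- by move=> w; exact: pindic_ge0.
Qed.

Lemma prob_chibad beta : 0 < beta ->
  (P (chibad (d%:R + 2 * Num.sqrt (d%:R * logc beta^-1) + 2 * logc beta^-1)) <= beta%:E)%E.
Proof.
move=> b0; set tau := logc _; set u0 := d%:R + _ + _.
have tau0 : 0 < tau by apply: (lt_le_trans ltr01); exact: logc_ge1.
pose A : set (I -> R) := [set u | u0 < \sum_i u (inl i) ^+ 2].
have mA : mvar (fun u : I -> R => (\1_A u : R)%:E).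
  rewrite (_ : (fun u : I -> R => _) = fun u => pindic (A u)); last first.
    by apply/funext => u; rewrite indic_pindic.
  apply: mvar_gt => d' S h mh; apply: measurable_sum => i; exact: measurable_funX.
rewrite -[chibad u0]/[set s | A (fun i => g i s)] (gauss_law (fun=> 0) mg gN gI mA).
rewrite (_ : (fun u : I -> R => _) = fun u => pindic (u0 < \sum_i u (inl i) ^+ 2)); last first.
  by apply/funext => u; rewrite indic_pindic.
by apply: (le_trans (chi2_bound _ d0 tau0)); rewrite lee_fin; exact: expRN_logc.
Qed.

Lemma opbadN_qform t s (z : 'I_d -> R) : ~ opbad t s ->
  `|qform (sym_from (fun jk => g (inr jk) s)) z| <= t * \sum_i z i ^+ 2.
Proof.
move=> nb; rewrite leNgt; apply/negP => lt; apply: nb.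
pose v (n : nat) : R := if insub n is Some i then z i else 0.
have vE (i : 'I_d) : v i = z i by rewrite /v valK.
exists v; rewrite /excess.
rewrite (_ : qf d _ v = qform (sym_from (fun jk => g (inr jk) s)) z); last first.
  apply: eq_bigr => i _; apply: eq_bigr => j _; rewrite !vE; congr (_ * _ * _).
  rewrite mxE /matW mul0r addr0 /upper; case: leqP => ij.
    exact: (ext_emb (fun i => g i s) (inr (i, j))).
  exact: (ext_emb (fun i => g i s) (inr (j, i))).
rewrite (_ : nrm2 d v = \sum_i z i ^+ 2); last by apply: eq_bigr => i _; rewrite vE.
rewrite (_ : dotp d _ v = 0); last by rewrite /dotp big1// => i _; rewrite mul0r.
by rewrite expr0n mul0r addr0 subr_gt0.
Qed.

End events.

Lemma sym_fromT d (w : 'I_d * 'I_d -> R) : (sym_from w)^T = sym_from w.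
Proof.
by apply/matrixP => i j; rewrite !mxE; case: (ltngtP i j) => // /val_inj ->.
Qed.

Lemma empCovT d n (X : 'M[R]_(d, n)) : (empCov X)^T = empCov X.
Proof. by rewrite /empCov linearZ /= trmx_mul trmxK. Qed.

(** An eigenvalue is a diagonal entry of [Q^T S Q], which is [n^-1] times the Gram matrix of the
    rows of [Q^T X]. *)
Lemma empCov_eig_ge0 d n (X : 'M[R]_(d, n)) Q (lam : 'rV[R]_d) i :
  sorted_eigdecomp (empCov X) Q lam -> 0 <= lam 0 i.
Proof.
move=> [QQ [SE _]]; have QQ' := mulmx1C QQ.
have E : Q^T *m empCov X *m Q = diag_mx lam.
  by rewrite SE !mulmxA QQ' mul1mx -mulmxA QQ' mulmx1.
have -> : lam 0 i = (Q^T *m empCov X *m Q) i i by rewrite E mxE eqxx mulr1n.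
have -> : Q^T *m empCov X *m Q = n%:R^-1 *: ((Q^T *m X) *m (Q^T *m X)^T).
  by rewrite /empCov -scalemxAr -scalemxAl trmx_mul trmxK !mulmxA.
rewrite mxE mulr_ge0 ?invr_ge0// mxE sumr_ge0// => k _.
by rewrite [X in _ * X]mxE -expr2 sqr_ge0.
Qed.

Lemma trace_eig d (A Q : 'M[R]_d) lam : sorted_eigdecomp A Q lam -> \tr A = \sum_i lam 0 i.
Proof.
move=> [QQ [-> _]]; rewrite -mulmxA mxtrace_mulC -mulmxA (mulmx1C QQ) mulmx1.
by apply: eq_bigr => i _; rewrite mxE eqxx mulr1n.
Qed.

Lemma frob_conj_diag d (O : 'M[R]_d) (c : R) (y : 'I_d -> R) : O *m O^T = 1%:M -> 0 <= c ->
  frob (O *m diag_mx (c *: \row_i y i) *m O^T) = c * Num.sqrt (\sum_i y i ^+ 2).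
Proof.
move=> OO c0; rewrite frobE mxdot_orth ?mxdot_diag; last exact: mulmx1C.
rewrite (_ : \sum_i _ = c ^+ 2 * \sum_i y i ^+ 2).
  by rewrite sqrtrM ?sqr_ge0// sqrtr_sqr ger0_norm.
by rewrite mulr_sumr; apply: eq_bigr => i _; rewrite !mxE; ring.
Qed.

(** The constant [2^(5/4)] is the square root of [4 sqrt 2]: 4 from [eigvec_perturb] and [sqrt 2]
    from the noise scale. *)
Lemma leading_term (rho tr t : R) (n : nat) : 0 < rho -> 0 <= tr -> 0 <= t -> (0 < n)%N ->
  Num.sqrt (4 * (Num.sqrt 2 / (Num.sqrt rho * n%:R)) * t * tr) =
  2 `^ (5%:R / 4%:R) * Num.sqrt tr / (rho `^ 4%:R^-1 * Num.sqrt n%:R) * Num.sqrt t.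
Proof.
move=> r0 tr0 t0 n0.
have p2 : (2 : R) `^ (5%:R / 4%:R) ^+ 2 = 4 * Num.sqrt 2.
  rewrite -powR_mulrn ?powR_ge0// -powRrM.
  rewrite (_ : 5%:R / 4%:R * 2%:R = 2%:R + 2^-1 :> R); last by field.
  by rewrite powRD ?pnatr_eq0 ?implybT// powR_mulrn// powR12_sqrt//; congr (_ * _); ring.
have pr : (rho `^ 4%:R^-1) ^+ 2 = Num.sqrt rho.
  rewrite -powR_mulrn ?powR_ge0// -powRrM (_ : 4%:R^-1 * 2%:R = 2^-1 :> R); last by field.
  by rewrite powR12_sqrt// ltW.
set RHS := (X in _ = X).
have R0 : 0 <= RHS by rewrite !mulr_ge0 ?invr_ge0 ?mulr_ge0 ?powR_ge0 ?sqrtr_ge0.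
rewrite -[RHS]ger0_norm// -sqrtr_sqr; congr Num.sqrt.
rewrite /RHS !exprMn exprVn !exprMn p2 pr !sqr_sqrtr//.
by rewrite invfM; ring.
Qed.

End final.

Theorem mainTheorem3 (R : realType) (dT : measure_display) (T : measurableType dT)
    (P : probability T R) (d n : nat) (X : 'M[R]_(d, n)) (rho beta : R)
    (lam : 'rV[R]_d) (Q : 'M[R]_d) (Psel : 'M[R]_d -> 'M[R]_d)
    (g : 'I_d + 'I_d * 'I_d -> {RV P >-> R}) :
  (0 < n)%N -> 0 < rho -> 0 < beta < 1 ->
  (forall i : 'I_n, \sum_(k < d) X k i ^+ 2 <= 1) ->
  sorted_eigdecomp (empCov X) Q lam ->
  eigvec_selector Psel ->
  (forall i A, measurable A -> distribution P (g i) A = normal_prob 0 1 A) ->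
  mutually_independent P (fun i => (g i : T -> R)) ->
  exists E : set T, measurable E /\
    E `<=` [set t | frob (separateCov X lam Psel rho (fun i => g (inl i) t)
                                      (fun jk => g (inr jk) t) - empCov X)
                    <= 2 `^ (5%:R / 4%:R) * Num.sqrt (\tr (empCov X))
                         / (rho `^ (4%:R^-1) * Num.sqrt n%:R)
                         * Num.sqrt (upsilon_fn d (beta / 2))
                       + Num.sqrt 2 / (Num.sqrt rho * n%:R) * eta_fn d (beta / 2)] /\
    ((1 - beta)%:E <= P E)%E.
Proof.
move=> n0 r0 /andP[b0 b1] _ eS sel gN gI.
case: (posnP d) => [dz|d0].
  (* For [d = 0] the error is the norm of an empty matrix, and the right-hand side is
     nonnegative. *)
  exists setT; split; first exact: measurableT.
  split; last by rewrite probability_setT lee_fin; lra.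
  move=> s _ /=; rewrite {1}/frob big1; last first.
    by move=> i _; have := ltn_ord i; rewrite {2}dz.
  rewrite sqrtr0 addr_ge0 ?mulr_ge0 ?invr_ge0 ?mulr_ge0 ?powR_ge0 ?sqrtr_ge0//.
have bh0 : 0 < beta / 2 by lra.
pose gg i : T -> R := g i.
have mg i : measurable_fun setT (gg i) by exact: measurable_funPT.
have gN' i B : measurable B -> P (gg i @^-1` B) = normal_prob 0 1 B by exact: gN.
pose t := upsilon_fn d (beta / 2).
pose tau := logc (beta / 2)^-1.
pose u0 := d%:R + 2 * Num.sqrt (d%:R * tau) + 2 * tau.
pose B1 := opbad gg t; pose B2 := chibad gg u0.
have mB1 : measurable B1 by exact: measurable_opbad.
have mB2 : measurable B2 by exact: measurable_chibad.
have pB1 : (P B1 <= (beta / 2)%:E)%E by exact: prob_opbad.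
have pB2 : (P B2 <= (beta / 2)%:E)%E by exact: prob_chibad.
have mU : measurable (B1 `|` B2) by exact: measurableU.
(* The good event is defined by the noise alone, hence measurable whatever the choice [Psel] of
   eigenvectors; on it the bound is deterministic. *)
exists (~` (B1 `|` B2)); split; first exact: measurableC.
split; last first.
  have PU : (P (B1 `|` B2) <= beta%:E)%E.
    apply: (le_trans (measureU2 _ _ _)) => //.
    by rewrite [in leRHS](splitr beta) EFinD leeD.
  by rewrite probability_setC// EFinB leeB.
move=> s nB /=; move: nB; rewrite setCU => -[nB1 nB2].
set y := fun i => g (inl i) s; set w := fun jk => g (inr jk) s.
set c : R := Num.sqrt 2 / (Num.sqrt rho * n%:R).
have nR0 : (0 : R) < n%:R by rewrite ltr0n.
have c0 : 0 <= c by rewrite divr_ge0// ?mulr_ge0 ?sqrtr_ge0.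
(* Spending [rho / 2] on the covariance gives its noise the same scale [c] as the eigenvalue
   noise. *)
have cE : (Num.sqrt (rho / 2) * n%:R)^-1 = c.
  rewrite sqrtrM ?ltW// sqrtrV// /c; field.
  by rewrite !gt_eqF// sqrtr_gt0.
rewrite /separateCov cE -/c.
set SG := empCov X + c *: sym_from w.
have sG : SG^T = SG by rewrite /SG linearD /= empCovT (linearZ _ (sym_from w)) /= sym_fromT.
have [mu eG] := sel SG sG.
set O := Psel SG in eG *.
have OO : O *m O^T = 1%:M by case: eG.
(* The error splits into the true eigenvalues on perturbed eigenvectors, minus [S], and the rotated
   diagonal noise. *)
rewrite linearD /= mulmxDr mulmxDl addrAC.
apply: (le_trans (frobD _ _)); apply: lerD; last first.
  rewrite frob_conj_diag// ler_wpM2l// /eta_fn -/tau ler_wsqrtr//.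
  by rewrite leNgt; apply/negP.
rewrite (trace_eig eS) -leading_term ?upsilon_ge0//; last first.
  by rewrite sumr_ge0// => i _; exact: empCov_eig_ge0 eS.
rewrite frobE ler_wsqrtr// -/c -/t.
apply: (eigvec_perturb eS eG) => //.
  by move=> i; exact: empCov_eig_ge0 eS.
by move=> z; exact: (opbadN_qform (g := gg) z nB1).
Qed.
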